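(* Let $\Omega$ be a compact (normal) domain in $\mathbb{R}^n$ with Dirichlet heat trace $Z(t)$, and let $\delta$ be the packing constant of $\Omega$ in $\mathbb{R}^n$. Then for all $t>0$, $$Z(t)\le\frac1\delta\,\frac{|\Omega|}{(4\pi t)^{n/2}}.$$
   Context: A normal domain in $\mathbb{R}^n$ is a compact codimension zero submanifold with piecewise smooth, Lipschitz boundary. The Dirichlet heat trace is $Z(t)=\sum_k e^{-\lambda_kt}$, where $\lambda_k$ are the eigenvalues, with multiplicity, of the Dirichlet Laplacian on $\Omega$ (the Friedrichs extension of $-\sum_i\partial_i^2$ on smooth functions supported away from $\partial\Omega$). $|\cdot|$ is volume. Packing constant: a packing $\mathcal{P}$ of $\mathbb{R}^n$ by $\Omega$ is a collection of pairwise disjoint congruent copies of $\Omega$. For a domain $G$, set $d_{\mathrm{out}}(\mathcal{P}|G)=\frac1{|G|}\sum_{A\in\mathcal{P},A\cap G\ne\emptyset}|A|$. A gauge is a pair $(G,o)$ of a bounded domain $G$ and a point $o$. With $\lambda G$ the image of $G$ under the homothety of scale $\lambda$ fixing $o$, put $d_+(\mathcal{P},G,o)=\limsup_{\lambda\to\infty}d_{\mathrm{out}}(\mathcal{P}|\lambda G)$. The packing constant $\delta$ of $\Omega$ is the supremum of $d_+(\mathcal{P},G,o)$ over all packings $\mathcal{P}$ by $\Omega$ and all gauges $(G,o)$.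
   Formalization: In the definition of the packing constant, the gauge domains G range over normal domains only, not arbitrary bounded domains: for a bounded open G whose boundary has positive volume the outer density can exceed 1, δ becomes infinite and the inequality fails. *)

(* Defs.v *)
From HB Require Import structures.
From mathcomp Require Import all_boot all_order all_algebra.
From mathcomp Require Import all_classical all_reals all_analysis.
From mathcomp Require Import measurable_realfun.

Set Implicit Arguments.
Unset Strict Implicit.
Unset Printing Implicit Defensive.

Import Order.TTheory GRing.Theory Num.Theory.
Import numFieldNormedType.Exports.

Local Open Scope classical_set_scope.
Local Open Scope ring_scope.

(* The Borel sigma-algebra of R^n. *)
HB.instance Definition _ (R : realType) (n : nat) :=
  Measurable.copy 'rV[R]_n (g_sigma_algebraType (@open 'rV[R]_n)).

Definition row_cons (R : realType) (n : nat) (xv : R * 'rV[R]_n) : 'rV[R]_n.+1 :=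
  \row_i oapp (xv.2 ord0) xv.1 (unlift ord0 i).

Definition rat_ball (R : realType) (n : nat) (c : 'rV[rat]_n * nat) :
  set 'rV[R]_n := ball (map_mx ratr c.1 : 'rV[R]_n) c.2.+1%:R^-1.

Lemma rat_ballP (R : realType) (n : nat) (c : 'rV[rat]_n * nat) (x : 'rV[R]_n) :
  rat_ball c x <-> forall i, `|ratr (c.1 ord0 i) - x ord0 i| < c.2.+1%:R^-1.
Proof.
split=> [[_ cx] i|cx]; first by have := cx ord0 i; rewrite mxE.
split=> [|i j]; first by rewrite invr_gt0.
by rewrite (ord1 i) mxE; exact: cx.
Qed.

Lemma rV_open_balls (R : realType) (n : nat) (U : set 'rV[R]_n) : open U ->
  U = \bigcup_(c in [set c : 'rV[rat]_n * nat | @rat_ball R n c `<=` U])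
        @rat_ball R n c.
Proof.
move=> oU; apply/seteqP; split => [x Ux|x [c /= cU]]; last exact: cU.
have /nbhs_ballP[e /= e0 eU] : nbhs x U by exact: open_nbhs_nbhs.
have [k ke] : exists k : nat, k.+1%:R^-1 < e / 2 :> R.
  have [N _ H] := near_infty_natSinv_lt (PosNum (divr_gt0 e0 (ltr0n R 2))).
  by exists N; exact: (H N (leqnn N)).
have k0 : 0 < k.+1%:R^-1 :> R by rewrite invr_gt0.
have qP i : exists q : rat,
    x ord0 i - k.+1%:R^-1 < ratr q :> R /\ ratr q < x ord0 i + k.+1%:R^-1 :> R.
  have [|q] := @rat_in_itvoo R (x ord0 i - k.+1%:R^-1) (x ord0 i + k.+1%:R^-1).
    by rewrite ltrD2l (lt_trans _ k0)// oppr_lt0.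
  by rewrite in_itv/= => /andP[? ?]; exists q.
have [q {}qP] := choice qP.
have qx : rat_ball (\row_i q i, k) x.
  by apply/rat_ballP => i /=; rewrite mxE ltr_distl; have [-> ->] := qP i.
exists (\row_i q i, k) => //= y.
move=> /rat_ballP /= qy; apply: eU; split => // i j.
rewrite (ord1 i) /ball/= (splitr e).
have /= := proj1 (rat_ballP _ _) qx j; move: (qy j).
rewrite !mxE => h1 h2.
rewrite -[_ - _](@subrKA _ (ratr (q j))) (le_lt_trans (ler_normD _ _))//.
by rewrite ltrD// (lt_trans _ ke)// distrC.
Qed.

Lemma rV_open_measurable (R : realType) (n : nat) (U : set 'rV[R]_n) :
  open U -> measurable U.
Proof. exact: sub_sigma_algebra. Qed.

Lemma measurable_rV_coord (R : realType) (n : nat) (i : 'I_n) :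
  measurable_fun setT (fun x : 'rV[R]_n => x ord0 i).
Proof.
apply: (measurability _ (RGenOInfty.measurableE R)) => //.
move=> _ [_ [a ->] <-]; rewrite setTI; apply: rV_open_measurable.
by apply: open_comp => [x _|]; [exact: coord_continuous | exact: interval_open].
Qed.

Lemma row_cons0 (R : realType) (n : nat) (xv : R * 'rV[R]_n) :
  row_cons xv ord0 ord0 = xv.1.
Proof. by rewrite mxE unlift_none. Qed.

Lemma row_consS (R : realType) (n : nat) (xv : R * 'rV[R]_n) (i : 'I_n) :
  row_cons xv ord0 (lift ord0 i) = xv.2 ord0 i.
Proof. by rewrite mxE liftK. Qed.

Lemma measurable_row_cons (R : realType) (n : nat) :
  measurable_fun setT (@row_cons R n).
Proof.
apply: (@measurability _ _ _ _ setT _ (@open 'rV[R]_n.+1)) => // _ [U oU <-].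
rewrite setTI (rV_open_balls oU) preimage_bigcup bigcup_mkcond.
apply: countable_bigcupT_measurable => // c; case: ifPn => // _.
set q := map_mx ratr c.1 : 'rV[R]_n.+1.
rewrite (_ : _ @^-1` _ = ball (q ord0 ord0) c.2.+1%:R^-1 `*`
  ball (\row_i q ord0 (lift ord0 i)) c.2.+1%:R^-1); last first.
  apply/seteqP; split => [xv /= /rat_ballP h|xv [h1 [_ h2]]].
    split; first by have := h ord0; rewrite row_cons0 /q mxE.
    split=> [|i j]; first by rewrite invr_gt0.
    by have := h (lift ord0 j); rewrite row_consS (ord1 i) /q !mxE.
  apply/rat_ballP => j; case: (unliftP ord0 j) => [k ->|->].
    by rewrite row_consS; have := h2 ord0 k; rewrite /q !mxE.
  by rewrite row_cons0; move: h1; rewrite /= /q mxE.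
apply: measurableX; first exact: measurable_ball.
by apply: rV_open_measurable; exact: ball_open.
Qed.

(* Lebesgue measure on R^n, as an iterated product of the one on R; lebesgue_rV_box
   below gives its value on boxes. *)
Fixpoint lebesgue_rV (R : realType) (n : nat) : set 'rV[R]_n -> \bar R :=
  match n return set 'rV[R]_n -> \bar R with
  | 0 => @dirac _ 'rV[R]_0 0 R
  | n'.+1 => pushforward (@lebesgue_measure R \x^ @lebesgue_rV R n')%E
               (@row_cons R n')
  end.

Lemma lebesgue_rV_measure (R : realType) (n : nat) :
  exists mu : {measure set 'rV[R]_n -> \bar R},
    @lebesgue_rV R n = mu :> (set 'rV[R]_n -> \bar R).
Proof.
elim: n => [|n [mu /= ->]]; first by eexists.
unshelve eexists.
  refine (pushforward (lebesgue_measure \x^ mu)%E (@row_cons R n)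
    : {measure set _ -> \bar R}).
  exact: measurable_row_cons.
by [].
Qed.

Section lebesgue_rV_isMeasure.
Context (R : realType) (n : nat).

Let lebesgue_rV0 : @lebesgue_rV R n set0 = 0%E.
Proof. by have [mu ->] := lebesgue_rV_measure R n; exact: measure0. Qed.

Let lebesgue_rV_ge0 A : (0 <= @lebesgue_rV R n A)%E.
Proof. by have [mu ->] := lebesgue_rV_measure R n; exact: measure_ge0. Qed.

Let lebesgue_rV_sigma_additive : semi_sigma_additive (@lebesgue_rV R n).
Proof.
by have [mu ->] := lebesgue_rV_measure R n; exact: measure_semi_sigma_additive.
Qed.

HB.instance Definition _ := isMeasure.Build _ _ _ (@lebesgue_rV R n)
  lebesgue_rV0 lebesgue_rV_ge0 lebesgue_rV_sigma_additive.

End lebesgue_rV_isMeasure.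

Lemma lebesgue_rV_box (R : realType) (n : nat) (a b : 'rV[R]_n) :
  (forall i, a ord0 i <= b ord0 i) ->
  @lebesgue_rV R n [set x | forall i, x ord0 i \in `]a ord0 i, b ord0 i]]
  = (\prod_(i < n) (b ord0 i - a ord0 i))%:E.
Proof.
have mbox k (u v : 'rV[R]_k) :
    measurable [set x : 'rV[R]_k | forall i, x ord0 i \in `]u ord0 i, v ord0 i]].
  rewrite (_ : mkset _ = \bigcap_(i in [set: 'I_k])
    ((fun x : 'rV[R]_k => x ord0 i) @^-1` `]u ord0 i, v ord0 i]%classic)).
    apply: fin_bigcap_measurable => // i _.
    by rewrite -[X in measurable X]setTI; exact: measurable_rV_coord.
  by apply/seteqP; split => x /= h i; [move=> _|]; exact: h.
elim: n a b => [|n ih] a b ab.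
  by rewrite big_ord0 /= diracE mem_set//= => -[].
pose a' : 'rV[R]_n := \row_j a ord0 (lift ord0 j).
pose b' : 'rV[R]_n := \row_j b ord0 (lift ord0 j).
pose B' : set 'rV[R]_n := [set x | forall i, x ord0 i \in `]a' ord0 i, b' ord0 i]].
rewrite big_ord_recl /= /pushforward.
have -> : @row_cons R n @^-1` [set x | forall i, x ord0 i \in `]a ord0 i, b ord0 i]]
    = `]a ord0 ord0, b ord0 ord0]%classic `*` B'.
  apply/seteqP; split => [xv /= h|xv /= [h1 h2] i].
    split; first by have := h ord0; rewrite row_cons0.
    by move=> i; have := h (lift ord0 i); rewrite row_consS !mxE.
  case: (unliftP ord0 i) => [j ->|->]; last by rewrite row_cons0.
  by rewrite row_consS; have := h2 j; rewrite !mxE.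
have [mu lebE] := lebesgue_rV_measure R n.
rewrite lebE product_measure2E//; last exact: mbox.
rewrite -lebE ih; last by move=> i; rewrite !mxE.
rewrite EFinM; congr (_ * _)%E.
  apply: (etrans (lebesgue_measure_itv `]a ord0 ord0, b ord0 ord0])) => /=.
  rewrite lte_fin; case: ltrP => // ba.
  by congr EFin; apply/esym/eqP; rewrite subr_eq0 eq_le ba ab.
by congr EFin; apply: eq_bigr => i _; rewrite !mxE.
Qed.

Section normal_domains.
Context {R : realType} {n : nat}.
Implicit Types (A : set 'rV[R]_n) (f : 'rV[R]_n -> R).

Definition dot (x y : 'rV[R]_n) : R := \sum_i x ord0 i * y ord0 i.

Definition partial (i : 'I_n) f : 'rV[R]_n -> R :=
  fun x => 'D_(delta_mx ord0 i) f x.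

(* C^infinity: every iterated partial derivative, of whatever order, is
   (Frechet) differentiable everywhere. *)
Definition smooth f : Prop :=
  forall (s : seq 'I_n) (x : 'rV[R]_n), differentiable (foldr partial f s) x.

Definition boundary A : set 'rV[R]_n := closure A `\` interior A.

(* Embedded smooth submanifold of codimension c, as a local regular zero set. *)
Definition smooth_submanifold (c : nat) (S : set 'rV[R]_n) : Prop :=
  forall p, S p -> exists F : 'I_c -> 'rV[R]_n -> R,
    [/\ forall k, smooth (F k),
        row_free (\matrix_(k < c, j < n) partial j (F k) p) &
        \forall x \near p, S x <-> forall k, F k x = 0].

(* Near each boundary point, in suitable orthonormal coordinates, A is the set
   of points above the graph of a Lipschitz function g: v is the unit vertical
   direction and x - (dot x v) *: v the horizontal component of x. *)
Definition lipschitz_boundary A : Prop :=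
  forall p, boundary A p -> exists (v : 'rV[R]_n) (g : 'rV[R]_n -> R),
    [/\ dot v v = 1,
        [lipschitz g x | x in setT] &
        \forall x \near p, A x <-> g (x - dot x v *: v) <= dot x v].

(* The boundary is a finite disjoint union of smooth pieces (faces, edges,
   corners and so on), each a submanifold of positive codimension. *)
Definition piecewise_smooth_boundary A : Prop :=
  exists (m : nat) (c : 'I_m -> nat) (S : 'I_m -> set 'rV[R]_n),
    [/\ forall k, (0 < c k)%N /\ smooth_submanifold (c k) (S k),
        trivIset setT S &
        boundary A = \bigcup_k S k].

(* The codimension zero submanifold structure is part of lipschitz_boundary. *)
Definition normal_domain A : Prop :=
  [/\ A !=set0, compact A, lipschitz_boundary A & piecewise_smooth_boundary A].

End normal_domains.

Section packing_constant.
Local Open Scope ereal_scope.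
Context {R : realType} {n : nat}.
Implicit Types (A B G Omega : set 'rV[R]_n) (P : set (set 'rV[R]_n)).

Definition congruent A B : Prop :=
  exists (Q : 'M[R]_n) (b : 'rV[R]_n),
    (Q *m Q^T = 1%:M)%R /\ A = [set (x *m Q + b)%R | x in B].

Definition packing Omega P : Prop :=
  (forall A, P A -> congruent A Omega) /\ trivIset P id.

Definition outer_density P G : \bar R :=
  (lebesgue_rV G)^-1 *
  \esum_(A in [set A | P A /\ A `&` G !=set0]) lebesgue_rV A.

Definition homothety (o : 'rV[R]_n) (l : R) G : set 'rV[R]_n :=
  [set (o + l *: (x - o))%R | x in G].

Definition upper_density P G (o : 'rV[R]_n) : \bar R :=
  limf_esup (fun l : R => outer_density P (homothety o l G)) (pinfty_nbhs R).

(* The gauge domains G are normal domains: for an arbitrary bounded open G the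
   boundary may have positive volume, and upper_density may then exceed 1. *)
Definition packing_constant Omega : \bar R :=
  ereal_sup [set d | exists P G (o : 'rV[R]_n),
    [/\ packing Omega P, normal_domain G & d = upper_density P G o]].

End packing_constant.

Section dirichlet_laplacian.
Context {R : realType} {n : nat}.
Variable Omega : set 'rV[R]_n.
Implicit Types u v f phi psi : 'rV[R]_n -> R.

Local Notation vol := (@lebesgue_rV R n).

Definition square_integrable u : Prop :=
  measurable_fun Omega u /\ (\int[vol]_(x in Omega) (u x ^+ 2)%:E < +oo)%E.

Definition inner u v : R := \int[vol]_(x in Omega) (u x * v x).

Definition test_function phi : Prop :=
  smooth phi /\ closure [set x | phi x != 0] `<=` interior Omega.

Definition neg_laplacian phi : 'rV[R]_n -> R :=
  fun x => - \sum_i partial i (partial i phi) x.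

(* Domain of the closure of the quadratic form of neg_laplacian on test
   functions: L^2 limits of sequences that are Cauchy for the form. *)
Definition form_domain u : Prop :=
  square_integrable u /\
  exists phi : nat -> 'rV[R]_n -> R,
    [/\ forall k, test_function (phi k),
        (fun k => inner (u \- phi k) (u \- phi k)) @ \oo --> (0 : R) &
        forall e : R, 0 < e -> exists N : nat, forall j k : nat,
          (N <= j)%N -> (N <= k)%N ->
          inner (neg_laplacian (phi j \- phi k)) (phi j \- phi k) < e].

(* Graph of the Friedrichs extension: the restriction of the adjoint of
   neg_laplacian (on test functions, in L^2(Omega)) to the form domain. *)
Definition friedrichs u f : Prop :=
  [/\ form_domain u, square_integrable f &
      forall psi, test_function psi -> inner f psi = inner u (neg_laplacian psi)].

Definition eigenfunction (l : R) u : Prop := friedrichs u (fun x => l * u x).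

Definition ae_zero u : Prop := {ae vol, forall x, Omega x -> u x = 0}.

Definition eigenvalues : set R :=
  [set l | exists u, eigenfunction l u /\ ~ ae_zero u].

(* Dimension, in L^2(Omega), of the eigenspace. *)
Definition multiplicity (l : R) : \bar R :=
  ereal_sup [set k%:R%:E | k in [set k : nat |
    exists u : 'I_k -> 'rV[R]_n -> R,
      (forall i, eigenfunction l (u i)) /\
      (forall c : 'I_k -> R,
        ae_zero (fun x => \sum_i c i * u i x) -> forall i, c i = 0)]].

(* A sum over the distinct eigenvalues, each weighted by its multiplicity. *)
Definition heat_trace (t : R) : \bar R :=
  (\esum_(l in eigenvalues) (multiplicity l * (expR (- l * t))%:E))%E.

End dirichlet_laplacian.

(* Main.v *)
(* A packing by disjoint copies of Omega has density at most 1, so delta <= 1 and it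
   suffices to prove Z(t) <= |Omega| / (4 pi t)^(n/2).

   Let K_t be convolution with the Gaussian heat kernel k_t of R^n, and let u be an
   L^2-normalized Dirichlet eigenfunction with eigenvalue l, extended by zero.
   Writing |u|^2 - <u, K_s u> as half the mean of the squared increments of u under k_s,
   and bounding the increments of test functions by their gradient, gives
   <u, K_s u> >= 1 - s l. Since <u, K_s u>^2 <= |K_s u|^2 = <u, K_(2s) u>, iterating
   from s = t / 2^m yields <u, K_t u> >= (1 - t l / 2^m)^(2^m), hence
   <u, K_t u> >= exp(- l t). Finally, by Bessel's inequality in L^2(Omega) for the
   functions k_(t/2)(z - .), integrated over z, the sum of <u, K_t u> = |K_(t/2) u|^2
   over an orthonormal family of eigenfunctions is at most |Omega| k_t(0). *)

Require Import Defs.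
From HB Require Import structures.
From mathcomp Require Import all_boot all_order all_algebra.
From mathcomp Require Import all_classical all_reals all_analysis.
From mathcomp Require Import measurable_realfun ring lra.

Set Implicit Arguments.
Unset Strict Implicit.
Unset Printing Implicit Defensive.

Import Order.TTheory GRing.Theory Num.Theory.
Import numFieldNormedType.Exports.

Local Open Scope classical_set_scope.
Local Open Scope ring_scope.

(** * Lebesgue measure on R^n *)

(** For normalized [u], the bound [<u, K_t u> >= exp(- l t)] is Jensen's inequality for the spectral
    measure of the free Laplacian at [u], whose mean is the Dirichlet energy [l]. Cauchy-Schwarz
    along dyadic times derives it from the first-order bound, so neither a spectral theorem nor the
    heat semigroup of [Omega] enters: everything is an explicit Gaussian integral over R^n. Two
    obstacles shape the rest. An eigenfunction extended by zero is only a limit of test functions in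
    the form norm, so its increments are split into those of a test function, where the gradient
    bound applies, and those of an L^2-small remainder. And the trace is a supremum over finite sets
    of eigenvalues, weighted by multiplicities that are themselves suprema, a priori infinite; the
    estimates are therefore made for finite orthonormal families and passed to the suprema one
    eigenvalue at a time. For the density bound, copies meeting a large gauge stay within a fixed
    distance of it; after rescaling, this margin shrinks to zero around a compact set, and
    continuity of measure concludes. *)

Lemma measurable_rV d (T : measurableType d) (R : realType) n (f : T -> 'rV[R]_n) :
  (forall i, measurable_fun setT (fun t => f t ord0 i)) -> measurable_fun setT f.
Proof.
move=> mf.
apply: (@measurability _ _ _ _ setT _ (@open 'rV[R]_n)) => // _ [U oU <-].
rewrite setTI (rV_open_balls oU) preimage_bigcup bigcup_mkcond.
apply: countable_bigcupT_measurable => // c; case: ifPn => // _.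
rewrite (_ : _ @^-1` _ = \bigcap_(i in [set: 'I_n])
  ((fun t => f t ord0 i) @^-1` ball (ratr (c.1 ord0 i) : R) c.2.+1%:R^-1)).
  apply: fin_bigcap_measurable => // i _.
  by rewrite -[X in measurable X]setTI; apply: mf => //; exact: measurable_ball.
apply/seteqP; split => t /=.
  by move/rat_ballP => h i _; exact: h.
by move=> h; apply/rat_ballP => i; exact: (h i I).
Qed.

Lemma measurable_rV_box (R : realType) n (a b : 'rV[R]_n) :
  measurable [set x : 'rV[R]_n | forall i, x ord0 i \in `]a ord0 i, b ord0 i]].
Proof.
rewrite (_ : mkset _ = \bigcap_(i in [set: 'I_n])
  ((fun x : 'rV[R]_n => x ord0 i) @^-1` `]a ord0 i, b ord0 i]%classic)).
  apply: fin_bigcap_measurable => // i _.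
  by rewrite -[X in measurable X]setTI; exact: measurable_rV_coord.
by apply/seteqP; split => x /= h i; [move=> _|]; exact: h.
Qed.

Section sigma_finite.
Context (R : realType) (n : nat).

Let sf : sigma_finite setT (@lebesgue_rV R n).
Proof.
exists (fun k => [set x : 'rV[R]_n | forall i, x ord0 i \in `](- k%:R), k%:R]]).
  apply/esym/seteqP; split => // x _.
  have [k hk] : exists k : nat, forall i, `|x ord0 i| < k%:R.
    exists (Num.trunc (\sum_i `|x ord0 i|)).+1 => i.
    apply: le_lt_trans (truncnS_gt _).
    by rewrite (bigD1 i)//= lerDl sumr_ge0.
  exists k => // i; rewrite in_itv /=.
  by have := hk i; rewrite ltr_norml => /andP[-> /ltW ->].
move=> k.
pose a : 'rV[R]_n := const_mx (- k%:R); pose b : 'rV[R]_n := const_mx k%:R.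
have -> : [set x : 'rV[R]_n | forall i, x ord0 i \in `](- k%:R), k%:R]] =
   [set x | forall i, x ord0 i \in `]a ord0 i, b ord0 i]].
  by apply/seteqP; split => x /= h i; move: (h i); rewrite !mxE.
split; first exact: measurable_rV_box.
rewrite lebesgue_rV_box ?ltry// => i; rewrite !mxE.
by rewrite (@le_trans _ _ 0)// oppr_le0.
Qed.

HB.instance Definition _ := Measure_isSigmaFinite.Build _ _ _ (@lebesgue_rV R n) sf.

End sigma_finite.

Lemma ge0_integral_rV0 (R : realType) (f : 'rV[R]_0 -> \bar R) :
  measurable_fun setT f ->
  (forall x, (0 <= f x)%E) -> (\int[@lebesgue_rV R 0]_x f x = f 0%R)%E.
Proof.
move=> mf f0; rewrite (_ : @lebesgue_rV R 0 = @dirac _ 'rV[R]_0 0 R)//.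
by rewrite integral_dirac// diracT mul1e.
Qed.

Lemma ge0_integral_rVS (R : realType) n (f : 'rV[R]_n.+1 -> \bar R) :
  measurable_fun setT f -> (forall x, (0 <= f x)%E) ->
  (\int[@lebesgue_rV R n.+1]_x f x =
   \int[@lebesgue_measure R]_a \int[@lebesgue_rV R n]_v f (row_cons (a, v)))%E.
Proof.
move=> mf f0.
have mr := @measurable_row_cons R n.
pose m2 : {measure set _ -> \bar R} := (@lebesgue_measure R \x^ @lebesgue_rV R n)%E.
transitivity (\int[pushforward m2 (@row_cons R n)]_x f x)%E; first by [].
have f0' : {in [set: 'rV[R]_n.+1], forall y, (0 <= f y)%E} by [].
have -> := @ge0_integral_pushforward _ _ (measurableTypeR R * 'rV[R]_n)%type _ R (@row_cons R n) mr m2 setT f measurableT mf f0'.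
rewrite preimage_setT.
(* The measure is built with [\x^], while Tonelli's theorem is stated for [\x]; uniqueness of the
   product measure identifies the two. *)
rewrite (@eq_measure_integral _ _ _ _ (@lebesgue_measure R \x @lebesgue_rV R n)%E).
  rewrite fubini_tonelli1//; last by move=> ?; exact: f0.
  by apply: measurableT_comp => //; exact: measurable_row_cons.
move=> A mA _ /=; apply/esym; apply: product_measure_unique => // B C mB mC.
exact: product_measure2E.
Qed.

Lemma measurable_affine (R : realType) (l h : R) :
  measurable_fun setT (fun x : measurableTypeR R => l * x + h : measurableTypeR R).
Proof. by apply: measurable_funD => //; exact: measurable_funM. Qed.

(** [l] times the pushforward of Lebesgue measure under [x |-> l * x + h] gives every interval []a,
    b]] its length, hence is Lebesgue measure by uniqueness. *)
Lemma ge0_integral_affineR (R : realType) (l h : R) (f : R -> \bar R) :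
  0 < l -> measurable_fun setT f -> (forall x, (0 <= f x)%E) ->
  (l%:E * \int[@lebesgue_measure R]_x f (l * x + h)%R =
   \int[@lebesgue_measure R]_x f x)%E.
Proof.
move=> l0 mf f0.
pose phi := fun x : measurableTypeR R => l * x + h : measurableTypeR R.
have mphi : measurable_fun setT phi by exact: measurable_affine.
pose nu0 : {measure set (measurableTypeR R) -> \bar R} :=
  mscale (NngNum (ltW l0)) (pushforward (@lebesgue_measure R) phi
    : {measure set _ -> \bar R}).
pose nu := nu0 mphi.
have nuE : forall X : set R, measurable X -> lebesgue_measure X = nu X.
  apply: lebesgue_measure_unique => _ [[a b] ab <-] /=.
  rewrite /nu /nu0 /mscale /= /pushforward.
  rewrite (_ : phi @^-1` _ = `](a - h) / l, (b - h) / l]%classic); last first.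
    apply/seteqP; split => x /=; rewrite !in_itv /= /phi.
      by rewrite ltr_pdivrMr// ler_pdivlMr// ltrBlDr lerBrDr (mulrC x).
    by rewrite ltr_pdivrMr// ler_pdivlMr// ltrBlDr lerBrDr (mulrC x).
  rewrite !lebesgue_measure_itv /= !lte_fin ltr_pM2r ?invr_gt0// ltrD2r.
  case: ifPn => _; last by rewrite mule0.
  rewrite -!EFinB -EFinM; congr EFin; field; lra.
transitivity (\int[nu]_x f x)%E; last first.
  by apply: eq_measure_integral => A mA _; apply/esym; exact: nuE.
rewrite /nu /nu0 ge0_integral_mscale//=; congr (_ * _)%E.
rewrite ge0_integral_pushforward//.
Qed.

Lemma row_cons_affine (R : realType) n (l a : R) (v : 'rV[R]_n) (h : 'rV[R]_n.+1) :
  l *: row_cons (a, v) + h =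
  row_cons (l * a + h ord0 ord0, l *: v + \row_i h ord0 (lift ord0 i)).
Proof.
apply/rowP => i; case: (unliftP ord0 i) => [j ->|->].
  by rewrite row_consS !mxE liftK.
by rewrite row_cons0 !mxE unlift_none.
Qed.

Lemma measurable_rV_affine (R : realType) n (l : R) (h : 'rV[R]_n) :
  measurable_fun setT (fun x : 'rV[R]_n => l *: x + h).
Proof.
apply: measurable_rV => i.
rewrite (_ : (fun t => _) = (fun t : 'rV[R]_n => l * t ord0 i + h ord0 i)); last first.
  by apply/funext => t; rewrite !mxE.
apply: measurable_funD => //; apply: measurable_funM => //.
exact: measurable_rV_coord.
Qed.

(** Each coordinate split off by Tonelli contributes one factor [l]. Translation invariance is the
    case [l = 1], and the scaling of volumes under homotheties comes from the same formula. *)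
Lemma ge0_integral_affine (R : realType) n (l : R) (h : 'rV[R]_n)
    (f : 'rV[R]_n -> \bar R) :
  0 < l -> measurable_fun setT f -> (forall x, (0 <= f x)%E) ->
  ((l ^+ n)%:E * \int[@lebesgue_rV R n]_x f (l *: x + h)%R =
   \int[@lebesgue_rV R n]_x f x)%E.
Proof.
move=> l0; elim: n h f => [|n ih] h f mf f0.
  have mf' : measurable_fun setT (fun x : 'rV[R]_0 => f (l *: x + h)).
    by apply: measurableT_comp => //; exact: measurable_rV_affine.
  rewrite !ge0_integral_rV0// expr0 mul1e; congr f.
  by apply/rowP => -[].
rewrite !ge0_integral_rVS//; last first.
  by apply: measurableT_comp => //; exact: measurable_rV_affine.
have mfr a : measurable_fun setT (fun v : 'rV[R]_n => f (row_cons (a, v))).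
  apply: measurableT_comp => //; apply: measurableT_comp => //.
  exact: measurable_row_cons.
under eq_integral => a _.
  under eq_integral => v _ do rewrite row_cons_affine.
  over.
pose F a := (\int[@lebesgue_rV R n]_v f (row_cons (a, v)))%E.
have mfc : measurable_fun setT (f \o @row_cons R n).
  by apply: measurableT_comp => //; exact: measurable_row_cons.
have mF : measurable_fun setT F.
  exact: (@measurable_fun_fubini_tonelli_F _ _ (measurableTypeR R) _ _
     (@lebesgue_rV R n) _ mfc (fun x => f0 (row_cons x))).
have F0 a : (0 <= F a)%E by apply: integral_ge0 => v _; exact: f0.
apply: etrans (ge0_integral_affineR (h ord0 ord0) l0 mF F0).
rewrite exprS EFinM -muleA; congr (_ * _)%E.
have mF' : measurable_fun setT (fun x : measurableTypeR R * 'rV[R]_n =>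
  f (row_cons (l * x.1 + h ord0 ord0, l *: x.2 + \row_i h ord0 (lift ord0 i)))).
  rewrite (_ : (fun _ => _) = fun x => f (l *: row_cons x + h)).
    apply: measurableT_comp => //.
    exact: (measurableT_comp (measurable_rV_affine l h) (@measurable_row_cons R n)).
  by apply/funext => -[a v]; rewrite row_cons_affine.
rewrite -ge0_integralZl//; last 3 first.
- exact: (@measurable_fun_fubini_tonelli_F _ _ (measurableTypeR R) _ _
     (@lebesgue_rV R n) _ mF' (fun x => f0 _)).
- by move=> a _; apply: integral_ge0 => v _; exact: f0.
- by rewrite lee_fin exprn_ge0// ltW.
apply: eq_integral => a _.
exact: (ih (\row_i h ord0 (lift ord0 i)) (fun v => f (row_cons (_, v)))).
Qed.

Lemma ge0_integral_translate (R : realType) n (h : 'rV[R]_n)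
    (f : 'rV[R]_n -> \bar R) :
  measurable_fun setT f -> (forall x, (0 <= f x)%E) ->
  (\int[@lebesgue_rV R n]_x f (x + h)%R = \int[@lebesgue_rV R n]_x f x)%E.
Proof.
move=> mf f0; have := ge0_integral_affine h ltr01 mf f0.
rewrite expr1n mul1e => <-.
by apply: eq_integral => x _; rewrite scale1r.
Qed.

Lemma measurable_rV_continuous (R : realType) n (f : 'rV[R]_n -> R) :
  continuous f -> measurable_fun setT f.
Proof.
move=> cf; apply: (measurability _ (RGenOInfty.measurableE R)) => //.
move=> _ [_ [a ->] <-]; rewrite setTI; apply: rV_open_measurable.
by apply: open_comp => [x _|]; [exact: cf | exact: interval_open].
Qed.

Lemma measurable_dot d (T : measurableType d) (R : realType) n (f g : T -> 'rV[R]_n) :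
  measurable_fun setT f -> measurable_fun setT g ->
  measurable_fun setT (fun t => dot (f t) (g t)).
Proof.
move=> mf mg; rewrite /dot; apply: measurable_sum => i.
apply: measurable_funM.
  exact: (measurableT_comp (@measurable_rV_coord R n i) mf).
exact: (measurableT_comp (@measurable_rV_coord R n i) mg).
Qed.

Lemma integral_gaussR (R : realType) (c : R) : 0 < c ->
  (\int[@lebesgue_measure R]_x (expR (- (c * x ^+ 2)))%:E)%E = (Num.sqrt (pi / c))%:E.
Proof.
move=> c0.
have s0 : 0 < Num.sqrt c by rewrite sqrtr_gt0.
have := @ge0_integral_affineR R (Num.sqrt c) 0 (EFin \o gauss_fun) s0.
move=> /(_ _ _)/= H.
have {H} : ((Num.sqrt c)%:E * (\int[@lebesgue_measure R]_x (expR (- (c * x ^+ 2)))%:E)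
   = (Num.sqrt pi)%:E)%E.
  rewrite -integralT_gauss -H//; last 2 first.
  - by apply/measurable_EFinP; exact: measurable_gauss_fun.
  - by move=> x; rewrite lee_fin gauss_fun_ge0.
  congr (_ * _)%E; apply: eq_integral => x _.
  by rewrite addr0 /gauss_fun exprMn sqr_sqrtr// ltW.
move=> /(congr1 (fun z => (Num.sqrt c)^-1%:E * z)%E).
rewrite muleA -!EFinM mulVf ?gt_eqF// mul1e => ->.
by rewrite sqrtrM ?pi_ge0// sqrtrV ?ltW// mulrC.
Qed.

Lemma dot_row_cons (R : realType) n (x : R * 'rV[R]_n) :
  dot (row_cons x) (row_cons x) = x.1 ^+ 2 + dot x.2 x.2.
Proof.
rewrite /dot big_ord_recl row_cons0 expr2; congr (_ + _).
by apply: eq_bigr => i _; rewrite row_consS.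
Qed.

Lemma integral_gauss (R : realType) n (c : R) : 0 < c ->
  (\int[@lebesgue_rV R n]_x (expR (- (c * dot x x)))%:E)%E =
  (Num.sqrt (pi / c) ^+ n)%:E.
Proof.
move=> c0.
have mg m : measurable_fun setT (fun x : 'rV[R]_m => (expR (- (c * dot x x)))%:E).
  apply/measurable_EFinP; apply: measurableT_comp => //.
  apply: measurableT_comp => //; apply: measurable_funM => //.
  exact: measurable_dot.
elim: n => [|n ih].
  rewrite ge0_integral_rV0//.
  by rewrite /dot big_ord0 mulr0 oppr0 expR0 expr0.
rewrite ge0_integral_rVS//.
transitivity (\int[@lebesgue_measure R]_a
    ((Num.sqrt (pi / c) ^+ n)%:E * (expR (- (c * a ^+ 2)))%:E))%E.
  apply: eq_integral => a _; rewrite muleC -ih -ge0_integralZl//.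
  by apply: eq_integral => v _; rewrite dot_row_cons mulrDr opprD expRD EFinM.
rewrite ge0_integralZl//; last first.
  apply/measurable_EFinP; apply: measurableT_comp => //.
  apply: measurableT_comp => //; apply: measurable_funM => //.
by rewrite integral_gaussR// -EFinM exprSr.
Qed.

(** * The Gaussian heat kernel *)

Lemma expR_ge1DxDx2 (R : realType) (x : R) : 0 <= x -> 1 + x + x ^+ 2 / 2 <= expR x.
Proof.
move=> x0.
have -> : 1 + x + x ^+ 2 / 2 = series (exp_coeff x) 3.
  rewrite /series /= !big_nat_recr//= big_nil /exp_coeff /=.
  by rewrite expr0 expr1 !divr1 add0r.
apply: nondecreasing_cvgn_le; last exact: is_cvg_series_exp_coeff.
by apply/nondecreasing_seqP => k; rewrite [leRHS]seriesSr lerDl exp_coeff_ge0.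
Qed.

(** With [z = x / 2], [e^x + e^(- x) - 2] is the square of [e^z - e^(- z)], which is at least [2 z]
    for [z >= 0]. *)
Lemma expRD_expRN_ge (R : realType) (x : R) : 2 + x ^+ 2 <= expR x + expR (- x).
Proof.
wlog x0 : x / 0 <= x => [h|].
  case: (leP 0 x) => [/h//|x0]; have := h (- x).
  by rewrite sqrrN opprK oppr_ge0 (addrC (expR _)); apply; exact: ltW.
set z := x / 2; have z0 : 0 <= z by rewrite divr_ge0.
have xE : x = z + z by rewrite /z; lra.
have e0 : 0 < expR z by exact: expR_gt0.
have ez := expR_ge1DxDx2 z0.
have p0 : 0 < 1 + z + z ^+ 2 / 2 by nra.
have -> : expR (- x) = (expR z)^-1 ^+ 2 by rewrite xE opprD expRD expRN.
have -> : expR x = expR z ^+ 2 by rewrite xE expRD.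
set a := expR z in e0 ez *; set b := a^-1.
have ab : a * b = 1 by rewrite mulfV// gt_eqF.
have b0 : 0 < b by rewrite invr_gt0.
have bz : b * (1 + z + z ^+ 2 / 2) <= 1 by nra.
have h : 2 * z <= a - b.
  (* Write [p = 1 + z + z^2 / 2]. Since [a >= p] and [b p <= 1], the claim reduces to
     [p^2 - 1 >= 2 z p], and these two sides differ by [z^4 / 4]. *)
  rewrite -(ler_pM2r p0).
  have : (1 + z + z ^+ 2 / 2) ^+ 2 - 1 <= (a - b) * (1 + z + z ^+ 2 / 2) by nra.
  apply: le_trans; nra.
have : (2 * z) ^+ 2 <= (a - b) ^+ 2 by rewrite ler_sqr ?nnegrE; lra.
have -> : x = 2 * z by rewrite /z; lra.
nra.
Qed.

Section dot.
Context {R : realType} {n : nat}.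
Implicit Types (x y z : 'rV[R]_n) (a : R).

Lemma dotC x y : dot x y = dot y x.
Proof. by apply: eq_bigr => i _; rewrite mulrC. Qed.

Lemma dotDl x y z : dot (x + y) z = dot x z + dot y z.
Proof. by rewrite /dot -big_split; apply: eq_bigr => i _; rewrite mxE mulrDl. Qed.

Lemma dotZl a x y : dot (a *: x) y = a * dot x y.
Proof. by rewrite /dot mulr_sumr; apply: eq_bigr => i _; rewrite mxE mulrA. Qed.

Lemma dotNl x y : dot (- x) y = - dot x y.
Proof. by rewrite -scaleN1r dotZl mulN1r. Qed.

Lemma dotDr x y z : dot x (y + z) = dot x y + dot x z.
Proof. by rewrite dotC dotDl !(dotC x). Qed.

Lemma dotZr a x y : dot x (a *: y) = a * dot x y.
Proof. by rewrite dotC dotZl (dotC x). Qed.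

Lemma dotNr x y : dot x (- y) = - dot x y.
Proof. by rewrite dotC dotNl (dotC x). Qed.

Lemma dot_ge0 x : 0 <= dot x x.
Proof. by apply: sumr_ge0 => i _; rewrite -expr2 sqr_ge0. Qed.

Lemma dot00 : dot (0 : 'rV[R]_n) 0 = 0.
Proof. by rewrite /dot big1// => i _; rewrite mxE mulr0. Qed.

End dot.

Definition dotE (R : realType) (n : nat) :=
  (@dotDl R n, @dotDr R n, @dotNl R n, @dotNr R n, @dotZl R n, @dotZr R n).

Section heat_kernel.
Context {R : realType} {n : nat}.
Implicit Types (x y z p : 'rV[R]_n) (t : R).
Local Notation vol := (@lebesgue_rV R n).

(** The kernel of [e^(t Laplacian)] on R^n. The normalization is written as an [n]-th power, the
    shape in which Tonelli produces the Gaussian integral. *)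
Definition heat_kernel t x : R :=
  (Num.sqrt (4 * pi * t) ^+ n)^-1 * expR (- (dot x x / (4 * t))).

Let C t : R := Num.sqrt (4 * pi * t) ^+ n.

Let C_gt0 t : 0 < t -> 0 < C t.
Proof. by move=> t0; rewrite exprn_gt0// sqrtr_gt0 !mulr_gt0// pi_gt0. Qed.

Lemma heat_kernel_ge0 t x : 0 <= heat_kernel t x.
Proof. by rewrite mulr_ge0 ?expR_ge0// invr_ge0 exprn_ge0// sqrtr_ge0. Qed.

Lemma heat_kernel0 t : heat_kernel t 0 = (Num.sqrt (4 * pi * t) ^+ n)^-1.
Proof. by rewrite /heat_kernel dot00 mul0r oppr0 expR0 mulr1. Qed.

Lemma heat_kernel_le t x : 0 < t -> heat_kernel t x <= heat_kernel t 0.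
Proof.
move=> t0; rewrite heat_kernel0 /heat_kernel ler_piMr//.
by rewrite expR_le1 oppr_le0 divr_ge0 ?dot_ge0// mulr_ge0// ltW.
Qed.

Lemma heat_kernelN t x : heat_kernel t (- x) = heat_kernel t x.
Proof. by rewrite /heat_kernel !dotE opprK. Qed.

Lemma heat_kernelB t x y : heat_kernel t (x - y) = heat_kernel t (y - x).
Proof. by rewrite -heat_kernelN opprB. Qed.

Lemma measurable_heat_kernel d (T : measurableType d) t (f : T -> 'rV[R]_n) :
  measurable_fun setT f -> measurable_fun setT (fun a => heat_kernel t (f a)).
Proof.
move=> mf; apply: measurable_funM => //; apply: measurableT_comp => //.
apply: measurableT_comp => //; apply: measurable_funM => //.
exact: measurable_dot.
Qed.

Lemma integral_gauss_translate t x : 0 < t ->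
  (\int[vol]_z (expR (- (t * dot (z - x) (z - x))))%:E)%E =
  (Num.sqrt (pi / t) ^+ n)%:E.
Proof.
move=> t0; rewrite -integral_gauss//.
rewrite -(@ge0_integral_translate R n (- x) (fun z => (expR (- (t * dot z z)))%:E))//.
apply/measurable_EFinP; apply: measurableT_comp => //.
apply: measurableT_comp => //; apply: measurable_funM => //.
exact: measurable_dot.
Qed.

Lemma integral_heat_kernel t : 0 < t -> (\int[vol]_x (heat_kernel t x)%:E = 1)%E.
Proof.
move=> t0; under eq_integral do rewrite /heat_kernel EFinM.
have t4 : 0 < (4 * t)^-1 by rewrite invr_gt0 mulr_gt0.
rewrite ge0_integralZl//; last first.
  apply/measurable_EFinP; apply: measurableT_comp => //.
  apply: measurableT_comp => //; apply: measurable_funM => //.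
  exact: measurable_dot.
under eq_integral do rewrite mulrC.
rewrite integral_gauss// invrK -EFinM.
have -> : pi * (4 * t) = 4 * pi * t by ring.
by rewrite mulVf ?gt_eqF// C_gt0.
Qed.

(** Complete the square around the midpoint [m]: [|z - x|^2 + |z - y|^2 = 2 |z - m|^2 + |x - y|^2 /
    2]. The equal-time case is the one that turns a squared L^2 norm at time [t] into a pairing at
    time [2 t]. *)
Lemma heat_kernel_semigroup t x y : 0 < t ->
  (\int[vol]_z (heat_kernel t (z - x) * heat_kernel t (z - y))%:E =
   (heat_kernel (2 * t) (x - y))%:E)%E.
Proof.
move=> t0.
have t2 : 0 < (2 * t)^-1 by rewrite invr_gt0 mulr_gt0.
pose m := 2^-1 *: (x + y).
have E z : heat_kernel t (z - x) * heat_kernel t (z - y) =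
  (C t ^- 2 * expR (- (dot (x - y) (x - y) / (4 * (2 * t))))) *
  expR (- ((2 * t)^-1 * dot (z - m) (z - m))).
  rewrite /heat_kernel -/(C t) mulrACA -expRD -expr2 exprVn -[RHS]mulrA -expRD.
  congr (_ * expR _); rewrite /m !dotE.
  rewrite (dotC y x) (dotC x z) (dotC y z); field; lra.
under eq_integral do rewrite E EFinM.
have mt : measurable_fun setT (fun z : 'rV[R]_n => z - m).
  by under eq_fun do rewrite -[X in X - _]scale1r; exact: measurable_rV_affine.
rewrite ge0_integralZl//; last 2 first.
- apply/measurable_EFinP; apply: measurableT_comp => //.
  apply: measurableT_comp => //; apply: measurable_funM => //.
  exact: measurable_dot.
- by rewrite lee_fin mulr_ge0 ?expR_ge0// invr_ge0 exprn_ge0// ltW// C_gt0.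
rewrite integral_gauss_translate// invrK -EFinM /heat_kernel mulrAC.
congr EFin; congr (_ * _).
have p0 := pi_gt0 R; have pt : 0 < pi * t by exact: mulr_gt0.
(* What remains is the identity of normalizations [C(t)^(-2) sqrt(2 pi t)^n = C(2 t)^(-1)], checked
   under the common [n]-th power. *)
rewrite /C -exprM mulnC exprM sqr_sqrtr; last by nra.
rewrite -!exprVn -exprMn; congr (_ ^+ n).
have a0 : 0 <= pi * (2 * t) by nra.
have b0 : 0 < 4 * pi * (2 * t) by nra.
apply: (mulIf (x := Num.sqrt (4 * pi * (2 * t)))); first by rewrite gt_eqF// sqrtr_gt0.
rewrite mulVf ?gt_eqF ?sqrtr_gt0// -[LHS]mulrA.
rewrite -sqrtrM//.
rewrite (_ : _ * _ * (4 * _ * _) = (4 * pi * t) ^+ 2); last by ring.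
by rewrite sqrtr_sqr gtr0_norm ?mulVf ?gt_eqF//; nra.
Qed.

(** Completing the square: the exponential tilt moves the Gaussian to the center [2 t p] and leaves
    the factor [e^(t |p|^2)]. *)
Lemma heat_kernel_mgf t p : 0 < t ->
  (\int[vol]_y (heat_kernel t y * expR (dot y p))%:E = (expR (t * dot p p))%:E)%E.
Proof.
move=> t0.
have E y : heat_kernel t y * expR (dot y p) =
  expR (t * dot p p) * heat_kernel t (y - (2 * t) *: p).
  rewrite /heat_kernel -[LHS]mulrA -expRD [RHS]mulrCA -expRD; congr (_ * expR _).
  rewrite !dotE (dotC p y); field; lra.
under eq_integral do rewrite E EFinM.
rewrite ge0_integralZl//; last 2 first.
- apply/measurable_EFinP; apply: measurable_heat_kernel.
  by under eq_fun do rewrite -[X in X - _]scale1r; exact: measurable_rV_affine.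
- by move=> y _; rewrite lee_fin heat_kernel_ge0.
rewrite (@ge0_integral_translate R n (- ((2 * t) *: p))
  (fun z => (heat_kernel t z)%:E))//; last 2 first.
- by apply/measurable_EFinP; exact: measurable_heat_kernel.
- by move=> y; rewrite lee_fin heat_kernel_ge0.
by rewrite integral_heat_kernel// mule1.
Qed.

(* From the moment generating function and [2 + s^2 w^2 <= e^(s w) + e^(- s w)],
   letting [s] tend to 0. *)
Lemma heat_kernel_moment2 t p : 0 < t ->
  (\int[vol]_y (heat_kernel t y * dot y p ^+ 2)%:E <= (2 * t * dot p p)%:E)%E.
Proof.
move=> t0; set I := (\int[vol]_y _)%E.
have mk : measurable_fun setT (heat_kernel t : 'rV[R]_n -> R).
  exact: measurable_heat_kernel.
have md : measurable_fun setT (fun y : 'rV[R]_n => dot y p).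
  exact: measurable_dot.
have I0 : (0 <= I)%E.
  by apply: integral_ge0 => y _; rewrite lee_fin mulr_ge0 ?heat_kernel_ge0 ?sqr_ge0.
have step s : 0 < s ->
    (2%:E + (s ^+ 2)%:E * I <= (2 * expR (t * (s ^+ 2 * dot p p)))%:E)%E.
  move=> s0.
  have -> : (2 * expR (t * (s ^+ 2 * dot p p)))%:E =
      (\int[vol]_y (heat_kernel t y * expR (dot y (s *: p)) +
                    heat_kernel t y * expR (dot y (- s *: p)))%:E)%E.
    under eq_integral do rewrite EFinD.
    rewrite ge0_integralD//; last 4 first.
    - by move=> y _; rewrite lee_fin mulr_ge0 ?heat_kernel_ge0 ?expR_ge0.
    - apply/measurable_EFinP; apply: measurable_funM => //.
      by apply: measurableT_comp => //; exact: measurable_dot.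
    - by move=> y _; rewrite lee_fin mulr_ge0 ?heat_kernel_ge0 ?expR_ge0.
    - apply/measurable_EFinP; apply: measurable_funM => //.
      by apply: measurableT_comp => //; exact: measurable_dot.
    have e a : t * dot (a *: p) (a *: p) = t * (a ^+ 2 * dot p p).
      by rewrite !dotE; ring.
    by rewrite !heat_kernel_mgf// -EFinD !e sqrrN; congr EFin; ring.
  have -> : (2%:E + (s ^+ 2)%:E * I =
      \int[vol]_y (2 * heat_kernel t y + s ^+ 2 * (heat_kernel t y * dot y p ^+ 2))%:E)%E.
    have mq : measurable_fun setT (fun y : 'rV[R]_n => heat_kernel t y * dot y p ^+ 2).
      by apply: measurable_funM => //; exact: measurable_funX.
    transitivity (\int[vol]_y (2%:E * (heat_kernel t y)%:E +
        (s ^+ 2)%:E * (heat_kernel t y * dot y p ^+ 2)%:E))%E; last by [].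
    rewrite ge0_integralD//; last 4 first.
    - by move=> y _; rewrite -EFinM lee_fin; have := heat_kernel_ge0 t y; lra.
    - by under eq_fun do rewrite -EFinM; apply/measurable_EFinP; exact: measurable_funM.
    - by move=> y _; rewrite -EFinM lee_fin mulr_ge0 ?sqr_ge0// mulr_ge0 ?sqr_ge0 ?heat_kernel_ge0.
    - by under eq_fun do rewrite -EFinM; apply/measurable_EFinP; exact: measurable_funM.
    rewrite ge0_integralZl//; last 2 first.
    - exact/measurable_EFinP.
    - by move=> y _; rewrite lee_fin heat_kernel_ge0.
    rewrite ge0_integralZl//; last 3 first.
    - exact/measurable_EFinP.
    - by move=> y _; rewrite lee_fin mulr_ge0 ?heat_kernel_ge0 ?sqr_ge0.
    - by rewrite lee_fin sqr_ge0.
    by rewrite integral_heat_kernel// mule1.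
  apply: ge0_le_integral => //.
  - move=> y _; rewrite lee_fin; apply: addr_ge0; apply: mulr_ge0 => //.
    + exact: heat_kernel_ge0.
    + exact: sqr_ge0.
    + by rewrite mulr_ge0 ?sqr_ge0 ?heat_kernel_ge0.
  - apply/measurable_EFinP; apply: measurable_funD; apply: measurable_funM => //.
    by apply: measurable_funM => //; exact: measurable_funX.
  - apply/measurable_EFinP; apply: measurable_funD; apply: measurable_funM => //.
      by apply: measurableT_comp => //; exact: measurable_dot.
    by apply: measurableT_comp => //; exact: measurable_dot.
  - move=> y _; rewrite lee_fin !dotE mulNr.
    have := expRD_expRN_ge (s * dot y p).
    have := heat_kernel_ge0 t y; nra.
(* The bound at [s = 1] already shows that the second moment is finite; the rest is real
   arithmetic. *)
have Ifin : I \is a fin_num.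
  rewrite ge0_fin_numE//; have := step 1 ltr01.
  by rewrite expr1n mul1e ltey; apply: contraTneq => ->.
set i := fine I; have i0 : 0 <= i by rewrite fine_ge0.
have IE : I = i%:E by rewrite fineK.
rewrite IE lee_fin.
set c := t * dot p p; have c0 : 0 <= c by rewrite mulr_ge0 ?dot_ge0// ltW.
(* The limit [s -> 0] in explicit form: [s^2 = w / (c + 1)] makes [s^2 c <= w], so the loss is a
   factor [1 - w]. The [+ 1] allows [c = 0]. *)
have {}step w : 0 < w < 1 -> i * (1 - w) <= 2 * c.
  move=> /andP[w0 w1].
  pose s := Num.sqrt (w / (c + 1)).
  have c1 : 0 < c + 1 by lra.
  have s0 : 0 < s by rewrite sqrtr_gt0 divr_gt0.
  have s2 : s ^+ 2 = w / (c + 1) by rewrite sqr_sqrtr// divr_ge0// ltW.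
  have := step s s0; rewrite IE -EFinM -EFinD lee_fin mulrCA -/c.
  have : s ^+ 2 * c <= w by rewrite s2 mulrAC ler_pdivrMr//; nra.
  have : 0 < s ^+ 2 by rewrite exprn_gt0.
  move: (s ^+ 2) => v v0 vw.
  have := expR_ge1Dx (- (v * c)); rewrite expRN.
  have := expR_gt0 (v * c).
  move: (expR _) => e e0.
  rewrite -(ler_pM2l e0) mulfV ?gt_eqF// => h1 h2.
  have h3 : v * i <= 2 * (e - 1) by lra.
  have h4 : (e - 1) * (1 - v * c) <= v * c by lra.
  have h5 : v * i * (1 - v * c) <= 2 * (v * c) by nra.
  have : i * (1 - v * c) <= 2 * c by rewrite -(ler_pM2l v0); lra.
  by nra.
rewrite -mulrA -/c leNgt; apply/negP => ic.
(* If [i > 2 c], this choice of [w] gives [i (1 - w) = (i + 2 c) / 2], which exceeds [2 c]. *)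
have h : 0 < (i - 2 * c) / (2 * i) < 1.
  have ? : 0 < i by lra.
  by rewrite divr_gt0 ?ltr_pdivrMr/=; lra.
have := step _ h.
suff -> : i * (1 - (i - 2 * c) / (2 * i)) = i - (i - 2 * c) / 2 by lra.
by field; lra.
Qed.

End heat_kernel.

(** * The L^2 inner product *)

Section L2.
Context {R : realType} {n : nat}.
Local Notation vol := (@lebesgue_rV R n).
Variable D : set 'rV[R]_n.
Hypothesis mD : measurable D.
Implicit Types u v w : 'rV[R]_n -> R.
Local Notation L2 := (square_integrable D).

Lemma integrable_sqr u : L2 u -> vol.-integrable D (fun x => (u x ^+ 2)%:E).
Proof.
move=> [mu ufin]; apply/integrableP; split.
  by apply/measurable_EFinP; exact: measurable_funX.
by under eq_integral do rewrite gee0_abs ?lee_fin ?sqr_ge0//.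
Qed.

Lemma integrable_mul u v : L2 u -> L2 v -> vol.-integrable D (fun x => (u x * v x)%:E).
Proof.
move=> Lu Lv.
have := integrableD mD (integrable_sqr Lu) (integrable_sqr Lv).
apply: le_integrable => //.
  by apply/measurable_EFinP; apply: measurable_funM; [have [] := Lu|have [] := Lv].
move=> x Dx /=; rewrite lee_fin.
rewrite (@ger0_norm _ (_ + _)) ?addr_ge0 ?sqr_ge0// ler_norml.
by apply/andP; split; nra.
Qed.

Lemma square_integrable_lin (c : R) u v : L2 u -> L2 v -> L2 (fun x => c * u x + v x).
Proof.
move=> Lu Lv; have [mu _] := Lu; have [mv _] := Lv; split.
  by apply: measurable_funD => //; exact: measurable_funM.
have : vol.-integrable D (fun x => ((c * u x + v x) ^+ 2)%:E).
  apply: eq_integrable (integrableD mD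
    (integrableZl mD (c ^+ 2) (integrable_sqr Lu))
    (integrableD mD (integrableZl mD (2 * c) (integrable_mul Lu Lv)) (integrable_sqr Lv))).
    exact: mD.
  by move=> x _ /=; rewrite -!EFinM -!EFinD; congr EFin; ring.
move=> /integrableP[_]; under eq_integral do rewrite gee0_abs ?lee_fin ?sqr_ge0//.
by [].
Qed.

Lemma square_integrable0 : L2 (fun=> 0).
Proof.
split; first exact: measurable_cst.
by under eq_integral do rewrite expr0n; rewrite integral0 ltry.
Qed.

Lemma square_integrableZ (c : R) u : L2 u -> L2 (fun x => c * u x).
Proof.
move=> Lu; have := square_integrable_lin c Lu square_integrable0.
by congr L2; apply/funext => x; rewrite addr0.
Qed.

Lemma square_integrableB u v : L2 u -> L2 v -> L2 (u \- v).
Proof.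
move=> Lu Lv; have := square_integrable_lin (-1) Lv Lu.
by congr L2; apply/funext => x /=; rewrite mulN1r addrC.
Qed.

Local Notation "'<< u , v >>" := (inner D u v) (at level 0, u at level 99, v at level 99).

Lemma innerC u v : '<<u, v>> = '<<v, u>>.
Proof. by apply: eq_Rintegral => x _; rewrite mulrC. Qed.

Lemma inner_linl (c : R) u v w : L2 u -> L2 v -> L2 w ->
  '<<fun x => c * u x + v x, w>> = c * '<<u, w>> + '<<v, w>>.
Proof.
move=> Lu Lv Lw; rewrite /inner.
rewrite -RintegralZl//; last exact: integrable_mul.
rewrite -RintegralD//; last 2 first.
- by apply: eq_integrable (integrableZl mD c (integrable_mul Lu Lw)).
- exact: integrable_mul.
by apply: eq_Rintegral => x _; rewrite mulrDl mulrA.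
Qed.

Lemma inner_linr (c : R) u v w : L2 u -> L2 v -> L2 w ->
  '<<w, fun x => c * u x + v x>> = c * '<<w, u>> + '<<w, v>>.
Proof. by move=> Lu Lv Lw; rewrite !(innerC w) inner_linl. Qed.

Lemma innerZl (c : R) u w : L2 u -> L2 w -> '<<fun x => c * u x, w>> = c * '<<u, w>>.
Proof.
move=> Lu Lw; rewrite /inner -RintegralZl//; last exact: integrable_mul.
by apply: eq_Rintegral => x _; rewrite mulrA.
Qed.

Lemma innerZr (c : R) u w : L2 u -> L2 w -> '<<w, fun x => c * u x>> = c * '<<w, u>>.
Proof. by move=> Lu Lw; rewrite !(innerC w) innerZl. Qed.

Lemma innerBl u v w : L2 u -> L2 v -> L2 w -> '<<u \- v, w>> = '<<u, w>> - '<<v, w>>.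
Proof.
move=> Lu Lv Lw; rewrite /inner -RintegralB//; [|exact: integrable_mul..].
by apply: eq_Rintegral => x _; rewrite mulrBl.
Qed.

Lemma innerBr u v w : L2 u -> L2 v -> L2 w -> '<<w, u \- v>> = '<<w, u>> - '<<w, v>>.
Proof. by move=> Lu Lv Lw; rewrite !(innerC w) innerBl. Qed.

Lemma square_integrable_sum (I : Type) (r : seq I) (f : I -> 'rV[R]_n -> R) :
  (forall i, L2 (f i)) -> L2 (fun x => \sum_(i <- r) f i x).
Proof.
move=> Lf; elim: r => [|i r ih].
  by under eq_fun do rewrite big_nil; exact: square_integrable0.
under eq_fun do rewrite big_cons -[f i _]mul1r.
exact: square_integrable_lin.
Qed.

Lemma inner_suml (I : Type) (r : seq I) (f : I -> 'rV[R]_n -> R) v :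
  (forall i, L2 (f i)) -> L2 v ->
  '<<fun x => \sum_(i <- r) f i x, v>> = \sum_(i <- r) '<<f i, v>>.
Proof.
move=> Lf Lv; elim: r => [|i r ih].
  rewrite big_nil /inner; under eq_Rintegral do rewrite big_nil mul0r.
  by rewrite Rintegral_cst// mul0r.
rewrite big_cons -ih -[X in X + _]mul1r -inner_linl//; last exact: square_integrable_sum.
by congr inner; apply/funext => x; rewrite big_cons mul1r.
Qed.

Lemma inner_ge0 u : 0 <= '<<u, u>>.
Proof. by apply: Rintegral_ge0 => x _; rewrite -expr2 sqr_ge0. Qed.

(** [inner] is the [fine] of an integral and would read an infinite one as 0; square integrability
    rules this out. *)
Lemma EFin_inner u : L2 u -> ('<<u, u>>%:E = \int[vol]_(x in D) (u x ^+ 2)%:E)%E.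
Proof.
move=> Lu; rewrite fineK//; last exact: integrable_fin_num (integrable_mul Lu Lu).
Qed.

Lemma cauchy_schwarz_inner u v : L2 u -> L2 v ->
  '<<u, v>> ^+ 2 <= '<<u, u>> * '<<v, v>>.
Proof.
move=> Lu Lv.
have q c : 0 <= c ^+ 2 * '<<u, u>> + 2 * c * '<<u, v>> + '<<v, v>>.
  have := inner_ge0 (fun x => c * u x + v x).
  have L := square_integrable_lin c Lu Lv.
  rewrite inner_linl// !inner_linr// (innerC v u); nra.
have uu := inner_ge0 u.
have [u0|u0] := eqVneq '<<u, u>> 0; last first.
  have := q (- '<<u, v>> / '<<u, u>>).
  set a := '<<u, u>> in u0 uu *; set b := '<<u, v>>; set d := '<<v, v>>.
  have a0 : 0 < a by rewrite lt0r u0.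
  rewrite (_ : _ + d = d - b ^+ 2 / a); last by field.
  by rewrite subr_ge0 ler_pdivrMr// mulrC.
rewrite u0 mul0r.
set b := '<<u, v>>; set d := '<<v, v>>.
have [->|b0] := eqVneq b 0; first by rewrite expr0n.
(* When [<u, u> = 0] the polynomial is affine in [c]; a nonzero [b] would let it take the value
   [-1]. *)
have := q (- (d + 1) / (2 * b)); rewrite u0 mulr0 add0r -/b -/d.
rewrite (_ : _ + d = -1); last by field.
by rewrite ler0N1.
Qed.

Lemma inner_eq0_ae u : L2 u -> '<<u, u>> = 0 -> ae_zero D u.
Proof.
move=> Lu u0; have [mu _] := Lu.
have := EFin_inner Lu; rewrite u0 => /esym i0.
have mu2 : measurable_fun D (fun x => (u x ^+ 2)%:E).
  by apply/measurable_EFinP; exact: measurable_funX.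
have /(ae_eq_integral_abs _ mD mu2) : (\int[vol]_(x in D) `|(u x ^+ 2)%:E| = 0)%E.
  by under eq_integral do rewrite gee0_abs ?lee_fin ?sqr_ge0//.
apply: filterS => x h Dx.
by have [/eqP] := h Dx; rewrite sqrf_eq0 => /eqP.
Qed.

Lemma square_integrable_restrict u : L2 u -> square_integrable setT (u \_ D).
Proof.
move=> [mu ufin]; split.
  by apply/(measurable_restrictT _ mD).
suff -> : (\int[vol]_x ((u \_ D) x ^+ 2)%:E = \int[vol]_(x in D) (u x ^+ 2)%:E)%E by [].
rewrite [RHS]integral_mkcond; apply: eq_integral => x _.
by rewrite !patchE; case: ifPn; rewrite // expr0n.
Qed.

(** Extension by zero carries the inner product to the whole space, where translations and
    convolution act. *)
Lemma inner_restrict u v : inner setT (u \_ D) (v \_ D) = '<<u, v>>.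
Proof.
rewrite /inner [RHS]Rintegral_mkcond; apply: eq_Rintegral => x _.
by rewrite !patchE; case: ifPn; rewrite // mulr0.
Qed.

End L2.

(** * Compact supports and difference quotients *)

Section rV_bounded.
Context {R : realType} {n : nat}.
Local Notation vol := (@lebesgue_rV R n).
Implicit Types (x y : 'rV[R]_n).

Lemma ler_coord_norm x i : `|x ord0 i| <= `|x|.
Proof.
rewrite [leRHS]mx_normrE.
exact: (le_bigmax_cond _ (fun ij : 'I_1 * 'I_n => `|x ij.1 ij.2|) (j := (ord0, i))).
Qed.

Lemma rV_norm_le x (r : R) : 0 <= r -> (forall i, `|x ord0 i| <= r) -> `|x| <= r.
Proof.
move=> r0 h; rewrite [leLHS]mx_normrE; apply: bigmax_le => // -[i j] _ /=.
by rewrite (ord1 i).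
Qed.

(** The norm on row vectors is the maximum norm, so this ball is a cube. *)
Definition cball0 (r : R) : set 'rV[R]_n := [set x | `|x| <= r].

Lemma closed_cball0 r : closed (cball0 r).
Proof.
rewrite (_ : cball0 r = (fun x => `|x|) @^-1` [set z | z <= r])//.
apply: closed_comp => [x _|]; first exact: norm_continuous.
exact: closed_le.
Qed.

Lemma compact_cball0 r : compact (cball0 r).
Proof.
apply: bounded_closed_compact; last exact: closed_cball0.
exists r; split; first exact: num_real.
by move=> M rM x /= /le_trans; apply; exact: ltW.
Qed.

Lemma closed_rV_measurable (A : set 'rV[R]_n) : closed A -> measurable A.
Proof.
move=> cA; rewrite -[A]setCK; apply: measurableC; apply: rV_open_measurable.
exact: closed_openC.
Qed.

Lemma compact_rV_closed (A : set 'rV[R]_n) : compact A -> closed A.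
Proof. by apply: compact_closed; exact: norm_hausdorff. Qed.

Lemma compact_rV_measurable (A : set 'rV[R]_n) : compact A -> measurable A.
Proof. by move=> /compact_rV_closed; exact: closed_rV_measurable. Qed.

Lemma compact_rV_bounded (A : set 'rV[R]_n) :
  compact A -> exists2 r, 0 < r & A `<=` cball0 r.
Proof.
move=> /compact_bounded[M [_ h]]; exists (Num.max 1 (M + 1)); first by rewrite lt_max ltr01.
by move=> x Ax; apply: h => //; rewrite lt_max ltrDl ltr01 orbT.
Qed.

Lemma lebesgue_cball0 r : (vol (cball0 r) < +oo)%E.
Proof.
have [r0|r0] := leP 0 r; last first.
  rewrite (_ : cball0 r = set0) ?measure0//; apply/seteqP; split => // x /= xr.
  by move: (normr_ge0 x); rewrite leNgt (le_lt_trans xr r0).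
(* Boxes are open on the left, hence the margin 1. *)
pose a : 'rV[R]_n := const_mx (- (r + 1)); pose b : 'rV[R]_n := const_mx (r + 1).
have ab i : a ord0 i <= b ord0 i by rewrite !mxE; lra.
pose B : set 'rV[R]_n := [set x | forall i, x ord0 i \in `]a ord0 i, b ord0 i]].
have vB : vol B = (\prod_(i < n) (b ord0 i - a ord0 i))%:E := lebesgue_rV_box ab.
apply: (@le_lt_trans _ _ (vol B)); last by rewrite vB ltry.
apply: le_measure; rewrite ?inE.
- by apply: closed_rV_measurable; exact: closed_cball0.
- exact: measurable_rV_box.
move=> x /= xr i; rewrite in_itv /= !mxE.
by have := le_trans (ler_coord_norm x i) xr; rewrite ler_norml; lra.
Qed.

End rV_bounded.

Section compact_support.
Context {R : realType} {n : nat}.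
Local Notation vol := (@lebesgue_rV R n).
Implicit Types (x y : 'rV[R]_n) (F G : 'rV[R]_n -> R).

(** The support is controlled by a radius rather than a closure, so products and linear combinations
    inherit the property pointwise. *)
Definition cc_fun F := continuous F /\ exists r, forall x, F x != 0 -> `|x| <= r.

Lemma cc_funM F G : cc_fun F -> cc_fun G -> cc_fun (fun x => F x * G x).
Proof.
move=> [cF [r hr]] [cG _]; split; first by move=> x; apply: continuousM; [exact: cF|exact: cG].
by exists r => x; rewrite mulf_eq0 negb_or => /andP[/hr].
Qed.

Lemma cc_fun_lin (c : R) F G : cc_fun F -> cc_fun G -> cc_fun (fun x => c * F x + G x).
Proof.
move=> [cF [r hr]] [cG [s hs]]; split.
  move=> x; apply: (@continuousD _ _ _ (fun x => c * F x) G x _ (cG x)).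
  by apply: (@continuousM _ _ (fun=> c) F x _ (cF x)); exact: cst_continuous.
exists (Num.max r s) => x.
have [F0|/hr h _] := eqVneq (F x) 0; last by rewrite le_max h.
by rewrite F0 mulr0 add0r => /hs h; rewrite le_max h orbT.
Qed.

Lemma cc_fun_bounded F : cc_fun F -> exists2 C, 0 <= C & forall x, `|F x| <= C.
Proof.
move=> [cF [r hr]].
have /compact_bounded[M [_ h]] : compact (F @` (cball0 r)).
  apply: continuous_compact; last exact: compact_cball0.
  exact: continuous_subspaceT.
exists (`|M| + 1); first by rewrite addr_ge0.
move=> x; have [->|/hr Fx] := eqVneq (F x) 0; first by rewrite normr0 addr_ge0.
apply: (h (`|M| + 1)); first by rewrite (le_lt_trans (ler_norm _))// ltrDl.
by exists x.
Qed.

Lemma cc_fun_measurable F : cc_fun F -> measurable_fun setT F.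
Proof. by move=> [cF _]; exact: measurable_rV_continuous. Qed.

Lemma integrable_indic_cball0 (C r : R) :
  vol.-integrable setT (fun x => (C * \1_(@cball0 R n r) x)%:E).
Proof.
have mB : measurable (@cball0 R n r).
  by apply: closed_rV_measurable; exact: closed_cball0.
have -> : (fun x => (C * \1_(@cball0 R n r) x)%:E) =
    (fun x => C%:E * (\1_(@cball0 R n r) x)%:E)%E by [].
apply: integrableZl => //; apply/integrableP; split.
  by apply/measurable_EFinP; exact: measurable_indic.
under eq_integral do rewrite gee0_abs ?lee_fin//.
by rewrite integral_indic// setIT lebesgue_cball0.
Qed.

Lemma bounded_support_integrable F (C r : R) : measurable_fun setT F ->
  (forall x, `|F x| <= C) -> (forall x, F x != 0 -> `|x| <= r) ->
  vol.-integrable setT (fun x => (F x)%:E).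
Proof.
move=> mF FC Fr; apply: le_integrable (integrable_indic_cball0 C r) => //.
  exact/measurable_EFinP.
move=> x _ /=; rewrite lee_fin.
have C0 : 0 <= C by exact: le_trans (FC x).
have [->|/Fr Fx] := eqVneq (F x) 0; first by rewrite normr0.
by rewrite indicE mem_set// mulr1 (ger0_norm C0).
Qed.

Lemma cc_fun_integrable F : cc_fun F -> vol.-integrable setT (fun x => (F x)%:E).
Proof.
move=> cF; have [C _ FC] := cc_fun_bounded cF; have [_ [r Fr]] := cF.
exact: bounded_support_integrable (cc_fun_measurable cF) FC Fr.
Qed.

Lemma cc_fun_square_integrable F : cc_fun F -> square_integrable setT F.
Proof.
move=> cF; split; first exact: cc_fun_measurable.
have /integrableP[_] := cc_fun_integrable (cc_funM cF cF).
by under eq_integral do rewrite -expr2 gee0_abs ?lee_fin ?sqr_ge0//.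
Qed.

Lemma is_derive_line F x y (s : R) : (forall z, derivable F z y) ->
  is_derive s (1 : R) (fun a : R => F (x + a *: y)) ('D_y F (x + s *: y)).
Proof.
move=> dF.
have E : (fun h : R => h^-1 *: (((fun a : R => F (x + a *: y)) \o shift s) (h *: (1 : R)) - F (x + s *: y)))
  = (fun h : R => h^-1 *: ((F \o shift (x + s *: y)) (h *: y) - F (x + s *: y))).
  apply/funext => h /=; congr (_ *: (F _ - _)).
  by rewrite [h *: 1]mulr1 scalerDl addrCA.
split; first by rewrite /derivable E; exact: dF.
by rewrite /derive E.
Qed.

Lemma diffquot_le F y (C : R) : (forall z, derivable F z y) ->
  (forall z, `|'D_y F z| <= C) ->
  forall x h, 0 <= h -> `|F (x + h *: y) - F x| <= C * h.
Proof.
move=> dF DC x h; rewrite le_eqVlt => /predU1P[<-|h0].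
  by rewrite scale0r addr0 subrr normr0 mulr0.
have D s := is_derive_line x s dF.
have [c _] : exists2 c : R, c \in `]0, h[ &
   F (x + h *: y) - F (x + 0 *: y) = 'D_y F (x + c *: y) * (h - 0).
  apply: (MVT (f := fun a => F (x + a *: y)) (df := fun a => 'D_y F (x + a *: y))) => //.
  apply: continuous_subspaceT => s; apply: differentiable_continuous.
  apply/derivable1_diffP; by case: (D s).
rewrite scale0r addr0 subr0 => ->.
by rewrite normrM (gtr0_norm h0) ler_pM2r.
Qed.

(** Dyadic steps, to match the doubling argument behind [integral_difference_sqr_le]. *)
Lemma diffquot_cvg F x y : derivable F x y ->
  ((2 ^+ k * (F (x + (2 ^- k) *: y) - F x)) @[k --> \oo] --> 'D_y F x).
Proof.
move=> dF.
have h0 : (2 ^- k : R) @[k --> \oo] --> (0 : R)^'.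
  have h : (2^-1 ^+ k : R) @[k --> \oo] --> (0 : R).
    by apply: cvg_expr; rewrite ger0_norm; lra.
  move=> A hA; have [N _ HN] := h _ hA; exists N => // k /= Nk.
  have := HN k Nk; rewrite /= exprVn; apply.
  by rewrite invr_neq0// expf_neq0.
rewrite (_ : (fun k => _) = (fun h => h^-1 *: ((F \o shift x) (h *: y) - F x)) \o
  (fun k => 2 ^- k)); first exact: cvg_comp h0 dF.
by apply/funext => k /=; rewrite invrK [_ *: _ in RHS]/GRing.scale/= (addrC x).
Qed.

End compact_support.

Section difference_quotients.
Context {R : realType} {n : nat}.
Local Notation vol := (@lebesgue_rV R n).
Implicit Types (x y h : 'rV[R]_n) (F G : 'rV[R]_n -> R).

Lemma measurable_translate h : measurable_fun setT (fun x : 'rV[R]_n => x + h).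
Proof.
by under eq_fun do rewrite -[X in X + _]scale1r; exact: measurable_rV_affine.
Qed.

Lemma integral_translate h (f : 'rV[R]_n -> \bar R) : measurable_fun setT f ->
  (\int[vol]_x f (x + h)%R = \int[vol]_x f x)%E.
Proof.
move=> mf; rewrite integralE [RHS]integralE.
congr (_ - _)%E.
  transitivity (\int[vol]_x f^\+ (x + h)%R)%E.
    by apply: eq_integral => x _; rewrite !funeposE.
  by apply: (@ge0_integral_translate R n h (f^\+)%E) => //; exact: measurable_funepos.
transitivity (\int[vol]_x f^\- (x + h)%R)%E.
  by apply: eq_integral => x _; rewrite !funenegE.
by apply: (@ge0_integral_translate R n h (f^\-)%E) => //; exact: measurable_funeneg.
Qed.

Lemma measurable_fun_translate h F : measurable_fun setT F ->
  measurable_fun setT (fun x => F (x + h)).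
Proof. by move=> mF; exact: (measurableT_comp mF (measurable_translate h)). Qed.

Lemma bounded_support_cvg (G_ : nat -> 'rV[R]_n -> R) G (C r : R) :
  (forall k, measurable_fun setT (G_ k)) -> measurable_fun setT G ->
  (forall k x, `|G_ k x| <= C) -> (forall k x, G_ k x != 0 -> `|x| <= r) ->
  (forall x, G_ k x @[k --> \oo] --> G x) ->
  ((\int[vol]_x (G_ k x)%:E)%E @[k --> \oo] --> (\int[vol]_x (G x)%:E)%E).
Proof.
move=> mG_ mG GC Gr cG.
have [] := @dominated_convergence _ _ _ vol setT measurableT
  (fun k x => (G_ k x)%:E) (fun x => (G x)%:E)
  (fun x => (C * \1_(@cball0 R n r) x)%:E) => //.
- by move=> k; exact/measurable_EFinP.
- exact/measurable_EFinP.
- by apply: aeW => x _; apply/cvg_EFin; [exact: nearW|exact: cG].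
- exact: integrable_indic_cball0.
- apply: aeW => x k _ /=; rewrite lee_fin.
  have C0 : 0 <= C by exact: le_trans (GC k x).
  have [->|/Gr Fx] := eqVneq (G_ k x) 0.
    by rewrite normr0 mulr_ge0// indicE.
  by rewrite indicE mem_set// mulr1.
Qed.

Variables (F : 'rV[R]_n -> R) (y : 'rV[R]_n).
Hypothesis dF : forall z, derivable F z y.
Hypothesis cF : cc_fun F.
Hypothesis cDF : cc_fun ('D_y F).

Let dq k x := 2 ^+ k * (F (x + (2 ^- k) *: y) - F x).

Let mdq k : measurable_fun setT (dq k).
Proof.
apply: measurable_funM => //; apply: measurable_funB; last exact: cc_fun_measurable.
by apply: measurable_fun_translate; exact: cc_fun_measurable.
Qed.

Let dq_bounded : exists C, forall k x, `|dq k x| <= C.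
Proof.
have [C C0 DC] := cc_fun_bounded cDF; exists C => k x.
have k0 : 0 < 2 ^+ k :> R by rewrite exprn_gt0.
have k1 : 0 <= 2 ^- k :> R by rewrite invr_ge0 ltW.
have h := diffquot_le dF DC x k1.
by rewrite /dq normrM (gtr0_norm k0) mulrC -ler_pdivlMr.
Qed.

Let dq_support : exists r, forall k x, dq k x != 0 -> `|x| <= r.
Proof.
have [_ [r hr]] := cF; exists (r + `|y|) => k x.
have [/hr xr _|] := boolP (F x != 0); first by rewrite (le_trans xr)// lerDl.
rewrite negbK => /eqP Fx; rewrite /dq Fx subr0 mulf_eq0 negb_or => /andP[_ /hr].
move=> h.
have -> : x = (x + 2 ^- k *: y) - 2 ^- k *: y by rewrite addrK.
rewrite (le_trans (ler_normB _ _))// lerD// normrZ ler_piMl//.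
rewrite ger0_norm ?invr_ge0 ?exprn_ge0// invf_le1 ?exprn_gt0//.
by rewrite exprn_ege1// ler1n.
Qed.

Let dq_cvg x : dq k x @[k --> \oo] --> 'D_y F x.
Proof. exact: diffquot_cvg. Qed.

(** Difference quotients integrate to zero by translation invariance and converge to the derivative
    under a common bound and support; this is the source of integration by parts. *)
Lemma integral_derive_eq0 : (\int[vol]_x ('D_y F x)%:E = 0)%E.
Proof.
have [C hC] := dq_bounded; have [r hr] := dq_support.
have := bounded_support_cvg mdq (cc_fun_measurable cDF) hC hr dq_cvg.
suff -> : (fun k => \int[vol]_x (dq k x)%:E)%E = cst 0%E.
  by move=> /(cvg_lim (@ereal_hausdorff R)) <-; rewrite lim_cst//; exact: ereal_hausdorff.
apply/funext => k.
have mF := cc_fun_measurable cF.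
have -> : (\int[vol]_x (dq k x)%:E =
   \int[vol]_x ((2 ^+ k)%:E * ((F (x + 2 ^- k *: y))%:E - (F x)%:E)))%E by [].
have iF : vol.-integrable setT (fun x => (F x)%:E) by exact: cc_fun_integrable.
have iFt : vol.-integrable setT (fun x => (F (x + 2 ^- k *: y))%:E).
  apply/integrableP; split.
    by apply/measurable_EFinP; exact: measurable_fun_translate.
  rewrite (@integral_translate _ (fun x => `|(F x)%:E|)%E); last first.
    by apply: measurableT_comp => //; exact/measurable_EFinP.
  by have /integrableP[] := iF.
rewrite integralZl//; last exact: integrableB.
rewrite integralB//.
rewrite (@integral_translate _ (fun x => (F x)%:E)); last exact/measurable_EFinP.
by rewrite subee ?mule0//; exact: integrable_fin_num iF.
Qed.

Let S h := (\int[vol]_x ((F (x + h) - F x) ^+ 2)%:E)%E.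

(** An increment by [2 h] is the sum of two increments by [h], one a translate of the other;
    [(a + b)^2 <= 2 a^2 + 2 b^2] and translation invariance do the rest. *)
Let S_double h : (S (2 *: h) <= 4%:E * S h)%E.
Proof.
have mF := cc_fun_measurable cF.
pose a x := F (x + h) - F x.
have ma : measurable_fun setT a.
  by apply: measurable_funB => //; exact: measurable_fun_translate.
have ma2 : measurable_fun setT (fun x => ((a x) ^+ 2)%:E).
  by apply/measurable_EFinP; exact: measurable_funX.
have ma2h : measurable_fun setT (fun x => ((a (x + h)) ^+ 2)%:E).
  by apply/measurable_EFinP; apply: measurable_funX; exact: measurable_fun_translate.
have a0 x : (0 <= ((a x) ^+ 2)%:E)%E by rewrite lee_fin sqr_ge0.
apply: (@le_trans _ _ (\int[vol]_x (2%:E * (a (x + h) ^+ 2)%:E + 2%:E * (a x ^+ 2)%:E))%E).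
  apply: ge0_le_integral => //.
  - by move=> x _; rewrite lee_fin sqr_ge0.
  - apply/measurable_EFinP; apply: measurable_funX; apply: measurable_funB => //.
    exact: measurable_fun_translate.
  - by apply: emeasurable_funD; apply: measurable_funeM.
  move=> x _; rewrite -!EFinM -EFinD lee_fin.
  have -> : F (x + 2 *: h) - F x = a (x + h) + a x.
    by rewrite /a -[x + h + h]addrA -mulr2n scaler_nat subrKA.
  by rewrite -subr_ge0; have := sqr_ge0 (a (x + h) - a x); lra.
rewrite ge0_integralD//; [|by move=> x _; rewrite mule_ge0|exact: measurable_funeM
  |by move=> x _; rewrite mule_ge0|exact: measurable_funeM].
rewrite !ge0_integralZl//.
rewrite (@integral_translate _ (fun x => (a x ^+ 2)%:E))// -/(S h).
by rewrite -ge0_muleDl// -EFinD lee_wpmul2r//; [by apply: integral_ge0 => x _; exact: a0|rewrite lee_fin; lra].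
Qed.

Let S_pow k h : (S h <= (4 ^+ k)%:E * S (2 ^- k *: h))%E.
Proof.
elim: k => [|k ih]; first by rewrite !expr0 invr1 scale1r mul1e.
rewrite (le_trans ih)// exprSr EFinM -muleA lee_wpmul2l ?lee_fin ?exprn_ge0//.
have := S_double (2 ^- k.+1 *: h).
by rewrite scalerA exprS invfM mulrA divff// mul1r.
Qed.

(** Iterated doubling bounds the left side by the squared L^2 norm of every dyadic difference
    quotient, and these norms converge to that of the derivative. This avoids Minkowski's integral
    inequality along the segment from [x] to [x + y]. *)
Lemma integral_difference_sqr_le :
  (\int[vol]_x ((F (x + y) - F x) ^+ 2)%:E <= \int[vol]_x ('D_y F x ^+ 2)%:E)%E.
Proof.
have [C hC] := dq_bounded; have [r hr] := dq_support.
have mD := cc_fun_measurable cDF.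
have : (\int[vol]_x (dq k x ^+ 2)%:E)%E @[k --> \oo] --> (\int[vol]_x ('D_y F x ^+ 2)%:E)%E.
  apply: (@bounded_support_cvg (fun k x => dq k x ^+ 2) (fun x => 'D_y F x ^+ 2) (C ^+ 2) r).
  - by move=> k; exact: measurable_funX.
  - exact: measurable_funX.
  - move=> k x; rewrite normrX ler_sqr ?nnegrE//.
    exact: le_trans (hC k x).
  - by move=> k x; rewrite sqrf_eq0; exact: hr.
  - by move=> x; rewrite expr2; apply: cvgM; exact: dq_cvg.
move=> /cvge_to_ge; apply; near=> k.
rewrite (le_trans (S_pow k y))// /S -ge0_integralZl//; last 2 first.
- apply/measurable_EFinP; apply: measurable_funX.
  apply: measurable_funB; last exact: cc_fun_measurable.
  by apply: measurable_fun_translate; exact: cc_fun_measurable.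
- by move=> x _; rewrite lee_fin sqr_ge0.
rewrite le_eqVlt; apply/orP; left; apply/eqP/eq_integral => x _.
by rewrite -EFinM /dq exprMn -exprM mulnC exprM; congr (_ ^+ _ * _)%:E; ring.
Unshelve. all: by end_near. Qed.

End difference_quotients.

(** * Test functions and the Dirichlet form *)

Section smooth_functions.
Context {R : realType} {n : nat}.
Implicit Types (x y : 'rV[R]_n) (f g : 'rV[R]_n -> R).

Lemma smooth_differentiable f x : smooth f -> differentiable f x.
Proof. by move=> sf; exact: (sf [::]). Qed.

Lemma smooth_continuous f : smooth f -> continuous f.
Proof. by move=> sf x; apply: differentiable_continuous; exact: smooth_differentiable. Qed.

Lemma smooth_derivable f x y : smooth f -> derivable f x y.
Proof. by move=> sf; apply: diff_derivable; exact: smooth_differentiable. Qed.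

Lemma smooth_partial i f : smooth f -> smooth (partial i f).
Proof. by move=> sf s x; rewrite -foldr_rcons; exact: sf. Qed.

Lemma partial_lin i (c : R) f g : smooth f -> smooth g ->
  partial i (fun x => c * f x + g x) = (fun x => c * partial i f x + partial i g x).
Proof.
move=> sf sg; apply/funext => x; rewrite /partial.
have df : derivable f x (delta_mx ord0 i) by exact: smooth_derivable.
have dg : derivable g x (delta_mx ord0 i) by exact: smooth_derivable.
have -> : (fun x => c * f x + g x) = c \*: f + g by [].
by rewrite deriveD ?deriveZ//; exact: derivableZ.
Qed.

Lemma smooth_lin (c : R) f g : smooth f -> smooth g -> smooth (fun x => c * f x + g x).
Proof.
move=> sf sg s x.
have -> : foldr partial (fun x => c * f x + g x) s =
    (fun x => c * foldr partial f s x + foldr partial g s x).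
  elim: s => //= i s ->; apply: partial_lin => s' z; rewrite -foldr_cat.
    exact: sf.
  exact: sg.
by apply: differentiableD; [apply: differentiableZ; exact: sf|exact: sg].
Qed.

Definition grad f x : 'rV[R]_n := \row_i partial i f x.

Lemma derive_grad f x y : smooth f -> 'D_y f x = dot y (grad f x).
Proof.
move=> sf; have df : differentiable f x by exact: smooth_differentiable.
rewrite deriveE// [in LHS](row_sum_delta y) linear_sum /dot.
apply: eq_bigr => i _; rewrite linearZ /= mxE; congr (_ * _).
by rewrite /partial deriveE.
Qed.

End smooth_functions.

Lemma measurable_addrV (R : realType) n :
  measurable_fun setT (fun z : 'rV[R]_n * 'rV[R]_n => z.2 + z.1).
Proof.
apply: measurable_rV => i; under eq_fun do rewrite mxE.
apply: measurable_funD.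
  exact: (measurableT_comp (@measurable_rV_coord R n i)).
exact: (measurableT_comp (@measurable_rV_coord R n i)).
Qed.

(* Locked, because [ring] and [lra] would otherwise unfold the form when they
   compare atoms. *)
HB.lock Definition dirichlet_form (R : realType) (n : nat)
  (phi psi : 'rV[R]_n -> R) : R :=
  \sum_i inner setT (partial i phi) (partial i psi).
Arguments dirichlet_form {R n} phi psi.

Section test_functions.
Context {R : realType} {n : nat}.
Variable Omega : set 'rV[R]_n.
Hypothesis cOmega : compact Omega.
Implicit Types (x y : 'rV[R]_n) (f g phi psi : 'rV[R]_n -> R).
Local Notation vol := (@lebesgue_rV R n).
Local Notation test := (test_function Omega).

Let mOmega : measurable Omega.
Proof. exact: compact_rV_measurable. Qed.

Lemma test_function_out phi x : test phi -> ~ Omega x -> phi x = 0.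
Proof.
move=> [_ sO] Ox; apply/eqP; apply: contra_notT Ox => /= px.
by apply: interior_subset; apply: sO; exact: subset_closure.
Qed.

Lemma test_function_restrict phi : test phi -> phi \_ Omega = phi.
Proof.
move=> tp; apply/funext => x; rewrite patchE; case: ifPn => //.
by rewrite notin_setE => /(test_function_out tp) ->.
Qed.

Lemma test_function_lin (c : R) phi psi : test phi -> test psi ->
  test (fun x => c * phi x + psi x).
Proof.
move=> [sp cp] [sq cq]; split; first exact: smooth_lin.
apply: (@subset_trans _ (closure ([set x | phi x != 0] `|` [set x | psi x != 0]))).
  apply: closure_subset => x /=.
  have [->|] := eqVneq (phi x) 0; last by left.
  by rewrite mulr0 add0r; right.
by rewrite closureU => x [/cp|/cq].
Qed.

Lemma test_functionB phi psi : test phi -> test psi -> test (phi \- psi).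
Proof.
move=> tp tq; have := test_function_lin (-1) tq tp.
by congr test; apply/funext => x /=; rewrite mulN1r addrC.
Qed.

(** Off its closed support [phi] vanishes near each point, so its derivatives vanish there too. *)
Lemma test_function_partial i phi : test phi -> test (partial i phi).
Proof.
move=> [sp cp]; split; first exact: smooth_partial.
apply: subset_trans cp.
have clS : closed (closure [set x | phi x != 0]) by exact: closed_closure.
rewrite [X in _ `<=` X]((closure_id _).1 clS).
apply: closure_subset => x /=; apply: contraNP => ncx.
have : nbhs x (~` closure [set x | phi x != 0]).
  apply: open_nbhs_nbhs; split => //; apply: closed_openC; exact: closed_closure.
move=> h.
have : \forall z \near x, phi z = cst 0 z.
  apply: filterS h => z /= nz; apply/eqP; apply: contra_notT nz => ?.
  exact: subset_closure.
by move=> /near_eq_derive E; rewrite /partial E derive_cst.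
Qed.

Lemma test_function_cc phi : test phi -> cc_fun phi.
Proof.
move=> tp; have [sp _] := tp; split; first exact: smooth_continuous.
have [r _ hr] := compact_rV_bounded cOmega; exists r => x px.
by apply: hr; apply: contra_notP (negP px) => Ox; apply/eqP; exact: test_function_out tp Ox.
Qed.

Lemma partial_prod i phi psi x : smooth phi -> smooth psi ->
  partial i (fun x => phi x * psi x) x = phi x * partial i psi x + psi x * partial i phi x.
Proof.
move=> sp sq.
have -> : (fun x => phi x * psi x) = phi * psi by [].
by rewrite /partial deriveM//; exact: smooth_derivable.
Qed.

(** The product [phi * psi] has bounded support, so the integral of its derivative is zero. *)
Lemma test_function_integration_by_parts i phi psi : test phi -> test psi ->
  inner setT (partial i phi) psi = - inner setT phi (partial i psi).
Proof.
move=> tp tq; have [sp _] := tp; have [sq _] := tq.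
have cp := test_function_cc tp; have cq := test_function_cc tq.
have cdp := test_function_cc (test_function_partial i tp).
have cdq := test_function_cc (test_function_partial i tq).
have E : partial i (fun x => phi x * psi x) =
    (fun x => phi x * partial i psi x + psi x * partial i phi x).
  by apply/funext => x; rewrite partial_prod.
have H : (\int[vol]_x (phi x * partial i psi x + psi x * partial i phi x)%:E = 0)%E.
  rewrite -[LHS](_ : \int[vol]_x (partial i (fun x => phi x * psi x) x)%:E = _)%E.
    apply: integral_derive_eq0.
    - by move=> z; apply: derivableM; exact: smooth_derivable.
    - exact: cc_funM.
    - rewrite -/(partial i _) E.
      have := cc_fun_lin 1 (cc_funM cp cdq) (cc_funM cq cdp).
      by under eq_fun do rewrite mul1r.
  by rewrite E.
apply/eqP; rewrite -addr_eq0 addrC; apply/eqP.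
rewrite /inner -RintegralD//; [|exact: cc_fun_integrable (cc_funM cp cdq)
  |exact: cc_fun_integrable (cc_funM cdp cq)].
rewrite /Rintegral; under eq_integral do rewrite (mulrC (partial i phi _)).
by rewrite H.
Qed.

(** Green's formula; it turns the form in [form_domain], written with [neg_laplacian], into an
    integral of gradients. *)
Lemma neg_laplacian_dirichlet phi psi : test phi -> test psi ->
  inner setT (neg_laplacian phi) psi = dirichlet_form phi psi.
Proof.
move=> tp tq; rewrite dirichlet_form.unlock.
have cdd i : cc_fun (partial i (partial i phi)).
  by apply: test_function_cc; do 2 apply: test_function_partial.
have cq := test_function_cc tq.
have Ldd i := cc_fun_square_integrable (cdd i).
have Lq := cc_fun_square_integrable cq.
have -> : neg_laplacian phi = (fun x => \sum_i (-1 * partial i (partial i phi) x)).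
  by apply/funext => x; rewrite -mulr_sumr mulN1r.
rewrite inner_suml//; last by move=> i; exact: square_integrableZ.
apply: eq_bigr => i _; rewrite innerZl// test_function_integration_by_parts//.
  by rewrite mulN1r opprK.
exact: test_function_partial.
Qed.

Lemma dirichlet_formC phi psi : dirichlet_form phi psi = dirichlet_form psi phi.
Proof. by rewrite dirichlet_form.unlock; apply: eq_bigr => i _; exact: innerC. Qed.

Lemma neg_laplacian_test phi : test phi -> test (neg_laplacian phi).
Proof.
move=> tp; rewrite /neg_laplacian; under eq_fun do rewrite -mulN1r mulr_sumr.
elim: (index_enum _) => [|i r ih].
  under eq_fun do rewrite big_nil.
  have := test_functionB tp tp; congr test.
  by apply/funext => x /=; rewrite subrr.
by under eq_fun do rewrite big_cons; apply: test_function_lin => //; do 2 apply: test_function_partial.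
Qed.

Lemma test_function_square_integrable phi : test phi -> square_integrable setT phi.
Proof. by move=> tp; apply: cc_fun_square_integrable; exact: test_function_cc. Qed.

Lemma test_function_square_integrable_in phi : test phi -> square_integrable Omega phi.
Proof.
move=> tp; have [mp fp] := test_function_square_integrable tp; split.
  exact: measurable_funS mp.
suff -> : (\int[vol]_(x in Omega) (phi x ^+ 2)%:E = \int[vol]_x (phi x ^+ 2)%:E)%E by [].
rewrite [LHS]integral_mkcond; apply: eq_integral => x _.
rewrite patchE; case: ifPn => //.
by rewrite notin_setE => /(test_function_out tp) ->; rewrite expr0n.
Qed.

Lemma inner_test u phi : test phi -> inner Omega u phi = inner setT (u \_ Omega) phi.
Proof. by move=> tp; rewrite -inner_restrict// (test_function_restrict tp). Qed.

Lemma inner_test_test phi psi : test phi -> test psi ->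
  inner Omega phi psi = inner setT phi psi.
Proof. by move=> tp tq; rewrite inner_test// (test_function_restrict tp). Qed.

(** For fixed [y], the squared increment integrates to at most the squared derivative along [y].
    With the integrals exchanged, the Gaussian average of [dot y (grad phi x) ^+ 2] is at most
    [2 t |grad phi x|^2] by the second moment. *)
Lemma test_function_heat_increment t phi : 0 < t -> test phi ->
  (\int[vol]_y \int[vol]_x (heat_kernel t y * (phi (x + y) - phi x) ^+ 2)%:E <=
   (2 * t * dirichlet_form phi phi)%:E)%E.
Proof.
move=> t0 tp; have [sp _] := tp.
have cp := test_function_cc tp; have mp := cc_fun_measurable cp.
have cg i : cc_fun (partial i phi).
  by apply: test_function_cc; exact: test_function_partial.
have mg : measurable_fun setT (grad phi).
  apply: measurable_rV => i; rewrite /grad; under eq_fun do rewrite mxE.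
  exact: cc_fun_measurable.
have mk : measurable_fun setT (heat_kernel t : 'rV[R]_n -> R).
  exact: measurable_heat_kernel.
have cD y : cc_fun ('D_y phi).
  have -> : 'D_y phi = fun x => \sum_i (y ord0 i * partial i phi x).
    apply/funext => x; rewrite derive_grad//; apply: eq_bigr => i _.
    by rewrite mxE.
  elim: (index_enum _) => [|i r ih].
    under eq_fun do rewrite big_nil.
    split; first by move=> x; exact: cst_continuous.
    by exists 0 => x; rewrite eqxx.
  by under eq_fun do rewrite big_cons; exact: cc_fun_lin.
pose H y x := (heat_kernel t y * dot y (grad phi x) ^+ 2)%:E.
have mH : measurable_fun setT (fun z : 'rV[R]_n * 'rV[R]_n => H z.1 z.2).
  apply/measurable_EFinP; apply: measurable_funM.
    exact: measurable_heat_kernel.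
  apply: measurable_funX; apply: measurable_dot => //.
  exact: (measurableT_comp mg).
have H0 y x : (0 <= H y x)%E.
  by rewrite lee_fin mulr_ge0 ?heat_kernel_ge0 ?sqr_ge0.
apply: (@le_trans _ _ (\int[vol]_y \int[vol]_x H y x)%E).
  apply: ge0_le_integral => //.
  - by move=> y _; apply: integral_ge0 => x _; rewrite lee_fin mulr_ge0 ?heat_kernel_ge0 ?sqr_ge0.
  - apply: (@measurable_fun_fubini_tonelli_F _ _ _ _ _ vol
     (fun z : 'rV[R]_n * 'rV[R]_n =>
       (heat_kernel t z.1 * (phi (z.2 + z.1) - phi z.2) ^+ 2)%:E)).
      apply/measurable_EFinP; apply: measurable_funM.
        exact: measurable_heat_kernel.
      apply: measurable_funX; apply: measurable_funB; last exact: measurableT_comp.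
      apply: (measurableT_comp mp); exact: measurable_addrV.
    by move=> z; rewrite lee_fin mulr_ge0 ?heat_kernel_ge0 ?sqr_ge0.
  - exact: (@measurable_fun_fubini_tonelli_F _ _ _ _ _ vol _ mH (fun z => H0 z.1 z.2)).
  move=> y _.
  have my : measurable_fun setT (fun x => phi (x + y) - phi x).
    by apply: measurable_funB => //; exact: measurable_fun_translate.
  have mDy : measurable_fun setT (fun x => dot y (grad phi x)).
    exact: measurable_dot.
  under eq_integral do rewrite EFinM.
  rewrite ge0_integralZl//; last 3 first.
  - by apply/measurable_EFinP; exact: measurable_funX.
  - by move=> x _; rewrite lee_fin sqr_ge0.
  - by rewrite lee_fin heat_kernel_ge0.
  rewrite /H; under [leRHS]eq_integral do rewrite EFinM.
  rewrite [leRHS]ge0_integralZl//; last 3 first.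
  - by apply/measurable_EFinP; exact: measurable_funX.
  - by move=> x _; rewrite lee_fin sqr_ge0.
  - by rewrite lee_fin heat_kernel_ge0.
  rewrite lee_wpmul2l ?lee_fin ?heat_kernel_ge0//.
  under [leRHS]eq_integral do rewrite -derive_grad//.
  apply: integral_difference_sqr_le => // z; exact: smooth_derivable.
rewrite (@fubini_tonelli _ _ _ _ _ vol vol _ mH)//=.
apply: (@le_trans _ _ (\int[vol]_x (2 * t * dot (grad phi x) (grad phi x))%:E)%E).
  apply: ge0_le_integral => //.
  - by move=> x _; apply: integral_ge0.
  - exact: (@measurable_fun_fubini_tonelli_G _ _ _ _ _ vol _ mH (fun z => H0 z.1 z.2)).
  - by apply/measurable_EFinP; apply: measurable_funM => //; exact: measurable_dot.
  by move=> x _; exact: heat_kernel_moment2.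
under eq_integral do rewrite EFinM.
rewrite ge0_integralZl//; last 3 first.
- by apply/measurable_EFinP; exact: measurable_dot.
- by move=> x _; rewrite lee_fin dot_ge0.
- by rewrite lee_fin mulr_ge0// ltW.
rewrite [leRHS]EFinM lee_wpmul2l//; first by rewrite lee_fin mulr_ge0// ltW.
rewrite dirichlet_form.unlock -sumEFin.
under [X in (_ <= X)%E]eq_bigr => i _.
  rewrite EFin_inner//; last by apply: cc_fun_square_integrable; exact: cg.
  over.
rewrite -ge0_integral_sum//; last 2 first.
- move=> i; apply/measurable_EFinP; apply: measurable_funX.
  exact: cc_fun_measurable.
- by move=> i x _; rewrite lee_fin sqr_ge0.
rewrite le_eqVlt; apply/orP; left; apply/eqP/eq_integral => x _.
by rewrite sumEFin; congr EFin; apply: eq_bigr => i _; rewrite !mxE expr2.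
Qed.

End test_functions.

(** * The heat semigroup *)

Section product_integral.
Context {R : realType} {n : nat}.
Local Notation vol := (@lebesgue_rV R n).
Implicit Types (f g : 'rV[R]_n -> R).

Lemma integrable_tensor f g :
  vol.-integrable setT (EFin \o f) -> vol.-integrable setT (EFin \o g) ->
  (vol \x vol)%E.-integrable setT (fun p => (f p.1 * g p.2)%:E).
Proof.
move=> If Ig; have /integrableP[mf ff] := If; have /integrableP[mg fg] := Ig.
have mf' : measurable_fun setT f by exact/measurable_EFinP.
have mg' : measurable_fun setT g by exact/measurable_EFinP.
apply/integrable12ltyP.
  by apply/measurable_EFinP; apply: measurable_funM; exact: measurableT_comp.
rewrite (_ : (fun x => _) = fun x =>
    (\int[vol]_y `|(g y)%:E| * `|(f x)%:E|)%E); last first.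
  apply/funext => x; under eq_integral do rewrite /= normrM EFinM.
  rewrite ge0_integralZl//; first by rewrite muleC.
  by apply/measurable_EFinP; apply: measurableT_comp.
rewrite ge0_integralZl//; last 2 first.
- by apply: measurableT_comp.
- exact: integral_ge0.
rewrite lte_mul_pinfty//; first exact: integral_ge0.
by rewrite ge0_fin_numE//; exact: integral_ge0.
Qed.

Lemma integral_tensor f g :
  vol.-integrable setT (EFin \o f) -> vol.-integrable setT (EFin \o g) ->
  (\int[(vol \x vol)%E]_p (f p.1 * g p.2)%:E =
   ((\int[vol]_x f x) * (\int[vol]_x g x))%:E)%E.
Proof.
move=> If Ig; rewrite -integral12_prod_meas1; last exact: integrable_tensor.
have fing : (\int[vol]_x (g x)%:E)%E \is a fin_num by exact: integrable_fin_num Ig.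
have finf : (\int[vol]_x (f x)%:E)%E \is a fin_num by exact: integrable_fin_num If.
rewrite /fubini_F /= (_ : (fun x => _) = fun x =>
    ((\int[vol]_y g y)%:E * (f x)%:E)%E); last first.
  apply/funext => x /=; under eq_integral do rewrite EFinM.
  by rewrite integralZl// fineK// muleC.
by rewrite integralZl// EFinM [RHS]muleC; congr (_ * _)%E; rewrite fineK.
Qed.

End product_integral.

(* A fresh constant for [vol \x vol], so that the sigma-finite structure of the
   product can be found: canonical inference on [\x] only finds the instance for
   probability measures. *)
Definition lebesgue_rV2 (R : realType) (n : nat) :
  set ('rV[R]_n * 'rV[R]_n) -> \bar R := (@lebesgue_rV R n \x @lebesgue_rV R n)%E.

HB.instance Definition _ (R : realType) (n : nat) := Measure.on (@lebesgue_rV2 R n).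

Lemma sigma_finite_lebesgue_rV2 (R : realType) (n : nat) :
  sigma_finite setT (@lebesgue_rV2 R n).
Proof.
have /sigma_finiteP[F [TF ndF Foo]] := sigma_finiteT (@lebesgue_rV R n).
exists (fun k => F k `*` F k).
  rewrite -setXTT TF predeqE => -[x y]; split.
    move=> [/= [k _ Fkx] [l _ Fly]]; exists (maxn k l) => //; split.
    - by move: x Fkx; exact/subsetPset/ndF/leq_maxl.
    - by move: y Fly; exact/subsetPset/ndF/leq_maxr.
  by move=> [k _ []/= ? ?]; split; exists k.
move=> k; have [? ?] := Foo k; split; first exact: measurableX.
by rewrite /lebesgue_rV2 product_measure1E// lte_mul_pinfty// ge0_fin_numE.
Qed.

HB.instance Definition _ (R : realType) (n : nat) :=
  Measure_isSigmaFinite.Build _ _ _ (@lebesgue_rV2 R n)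
    (@sigma_finite_lebesgue_rV2 R n).

Section heat_semigroup.
Context {R : realType} {n : nat}.
Local Notation vol := (@lebesgue_rV R n).
Local Notation k := (@heat_kernel R n).
Implicit Types (x y z : 'rV[R]_n) (t : R).

Definition heat_apply t (u : 'rV[R]_n -> R) z : R := \int[vol]_x (k t (z - x) * u x).

(** This is [<u, K_t u>], taken as a double integral so that it makes sense before [K_t u] is known
    to be square integrable. *)
Definition heat_pairing t (u : 'rV[R]_n -> R) : R :=
  \int[(vol \x vol)%E]_p (k t (p.1 - p.2) * (u p.1 * u p.2)).

(** The inner integral is over [x] because the derivative bound on increments holds for each fixed
    shift [y]. *)
Definition heat_increment t (u : 'rV[R]_n -> R) : \bar R :=
  (\int[vol]_y \int[vol]_x (k t y * (u (x + y) - u x) ^+ 2)%:E)%E.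

Lemma measurable_heat_kernelB d (T : measurableType d) t (f g : T -> 'rV[R]_n) :
  measurable_fun setT f -> measurable_fun setT g ->
  measurable_fun setT (fun a => k t (f a - g a)).
Proof.
move=> mf mg; apply: measurable_heat_kernel; apply: measurable_rV => i.
under eq_fun do rewrite mxE [X in _ + X]mxE.
apply: measurable_funB.
  exact: (measurableT_comp (@measurable_rV_coord R n i) mf).
exact: (measurableT_comp (@measurable_rV_coord R n i) mg).
Qed.

Lemma integral_heat_kernelB t x : 0 < t -> (\int[vol]_y (k t (x - y))%:E = 1)%E.
Proof.
move=> t0; under eq_integral do rewrite heat_kernelB.
rewrite (@ge0_integral_translate R n (- x) (fun y => (k t y)%:E))//.
- exact: integral_heat_kernel.
- by apply/measurable_EFinP; exact: measurable_heat_kernel.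
- by move=> y; rewrite lee_fin heat_kernel_ge0.
Qed.

Section fixed_function.
Variables (t : R) (u : 'rV[R]_n -> R).
Hypothesis t0 : 0 < t.
Hypothesis Lu : square_integrable setT u.

Let mu : measurable_fun setT u. Proof. by have [] := Lu. Qed.

Let nrm := inner setT u u.

Let nrmE : (\int[vol]_x (u x ^+ 2)%:E = nrm%:E)%E.
Proof. by rewrite /nrm EFin_inner. Qed.

Let mk12 : measurable_fun setT (fun p : 'rV[R]_n * 'rV[R]_n => k t (p.1 - p.2)).
Proof. exact: measurable_heat_kernelB. Qed.

Let mu1 : measurable_fun setT (fun p : 'rV[R]_n * 'rV[R]_n => u p.1).
Proof. exact: measurableT_comp. Qed.

Let mu2 : measurable_fun setT (fun p : 'rV[R]_n * 'rV[R]_n => u p.2).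
Proof. exact: measurableT_comp. Qed.

Let ku1E : (\int[(vol \x vol)%E]_p (k t (p.1 - p.2) * u p.1 ^+ 2)%:E = nrm%:E)%E.
Proof.
rewrite fubini_tonelli1; last 2 first.
- apply/measurable_EFinP; apply: measurable_funM => //; exact: measurable_funX.
- by move=> p; rewrite lee_fin mulr_ge0 ?heat_kernel_ge0 ?sqr_ge0.
rewrite -nrmE; apply: eq_integral => x _; rewrite /fubini_F /=.
under eq_integral do rewrite mulrC EFinM.
rewrite ge0_integralZl//; last 3 first.
- by apply/measurable_EFinP; exact: measurable_heat_kernelB.
- by move=> y _; rewrite lee_fin heat_kernel_ge0.
- by rewrite lee_fin sqr_ge0.
by rewrite integral_heat_kernelB// mule1.
Qed.

Let ku2E : (\int[(vol \x vol)%E]_p (k t (p.1 - p.2) * u p.2 ^+ 2)%:E = nrm%:E)%E.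
Proof.
rewrite fubini_tonelli2; last 2 first.
- apply/measurable_EFinP; apply: measurable_funM => //; exact: measurable_funX.
- by move=> p; rewrite lee_fin mulr_ge0 ?heat_kernel_ge0 ?sqr_ge0.
rewrite -nrmE; apply: eq_integral => x _; rewrite /fubini_G /=.
under eq_integral do rewrite mulrC EFinM heat_kernelB.
rewrite ge0_integralZl//; last 3 first.
- by apply/measurable_EFinP; exact: measurable_heat_kernelB.
- by move=> y _; rewrite lee_fin heat_kernel_ge0.
- by rewrite lee_fin sqr_ge0.
by rewrite integral_heat_kernelB// mule1.
Qed.

Let iku1 : (vol \x vol)%E.-integrable setT (fun p => (k t (p.1 - p.2) * u p.1 ^+ 2)%:E).
Proof.
apply/integrableP; split.
  apply/measurable_EFinP; apply: measurable_funM => //; exact: measurable_funX.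
under eq_integral do (rewrite gee0_abs;
  last by rewrite lee_fin mulr_ge0 ?heat_kernel_ge0 ?sqr_ge0).
by rewrite ku1E ltry.
Qed.

Let iku2 : (vol \x vol)%E.-integrable setT (fun p => (k t (p.1 - p.2) * u p.2 ^+ 2)%:E).
Proof.
apply/integrableP; split.
  apply/measurable_EFinP; apply: measurable_funM => //; exact: measurable_funX.
under eq_integral do (rewrite gee0_abs;
  last by rewrite lee_fin mulr_ge0 ?heat_kernel_ge0 ?sqr_ge0).
by rewrite ku2E ltry.
Qed.

(** Schur's test: [|u(x) u(y)| <= u(x)^2 + u(y)^2], and the kernel has mass 1 in each variable. *)
Lemma integrable_heat_pairing :
  (vol \x vol)%E.-integrable setT (fun p => (k t (p.1 - p.2) * (u p.1 * u p.2))%:E).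
Proof.
apply: le_integrable (integrableD measurableT iku1 iku2) => //.
  by apply/measurable_EFinP; apply: measurable_funM => //; exact: measurable_funM.
move=> p _ /=; rewrite lee_fin.
have k0 := heat_kernel_ge0 t (p.1 - p.2).
rewrite [leRHS]ger0_norm; last by apply: addr_ge0; apply: mulr_ge0; rewrite ?sqr_ge0.
rewrite normrM (ger0_norm k0) -mulrDr ler_wpM2l// ler_norml.
by apply/andP; split; nra.
Qed.

(** Shifting [y] by [x] turns the increment into the integral of [(u(x) - u(y))^2] against the
    kernel at [x - y]. In the expanded square, each pure term contributes [nrm] because the kernel
    has mass 1. *)
Lemma heat_incrementE : heat_increment t u = (2 * nrm - 2 * heat_pairing t u)%:E.
Proof.
pose H y x := (k t y * (u (x + y) - u x) ^+ 2)%:E.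
have mH : measurable_fun setT (fun z : 'rV[R]_n * 'rV[R]_n => H z.1 z.2).
  apply/measurable_EFinP; apply: measurable_funM.
    exact: measurable_heat_kernel.
  apply: measurable_funX; apply: measurable_funB; last exact: measurableT_comp.
  apply: (measurableT_comp mu); exact: measurable_addrV.
have H0 y x : (0 <= H y x)%E.
  by rewrite lee_fin mulr_ge0 ?heat_kernel_ge0 ?sqr_ge0.
transitivity (\int[vol]_x \int[vol]_y H y x)%E.
  have E := @fubini_tonelli _ _ _ _ _ vol vol _ mH (fun p => H0 p.1 p.2).
  by rewrite /heat_increment; apply: etrans E _.
transitivity (\int[(vol \x vol)%E]_p (k t (p.1 - p.2) * (u p.1 - u p.2) ^+ 2)%:E)%E.
  rewrite fubini_tonelli1; last 2 first.
  - apply/measurable_EFinP; apply: measurable_funM => //; apply: measurable_funX.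
    exact: measurable_funB.
  - by move=> p; rewrite lee_fin mulr_ge0 ?heat_kernel_ge0 ?sqr_ge0.
  apply: eq_integral => x _; rewrite /fubini_F /=.
  rewrite -(@ge0_integral_translate R n x
    (fun y => (k t (x - y) * (u x - u y) ^+ 2)%:E))//; last 2 first.
  - apply/measurable_EFinP; apply: measurable_funM; first exact: measurable_heat_kernelB.
    by apply: measurable_funX; exact: measurable_funB.
  - by move=> y; rewrite lee_fin mulr_ge0 ?heat_kernel_ge0 ?sqr_ge0.
  apply: eq_integral => y _; rewrite /H (addrC y x) opprD addrA subrr add0r heat_kernelN.
  by rewrite -sqrrN opprB.
have -> : (\int[(vol \x vol)%E]_p (k t (p.1 - p.2) * (u p.1 - u p.2) ^+ 2)%:E =
  \int[(vol \x vol)%E]_p ((k t (p.1 - p.2) * u p.1 ^+ 2)%:E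
    + (k t (p.1 - p.2) * u p.2 ^+ 2)%:E
    - 2%:E * (k t (p.1 - p.2) * (u p.1 * u p.2))%:E))%E.
  by apply: eq_integral => p _; rewrite -EFinM -!EFinD; congr EFin; ring.
rewrite integralB//; last 2 first.
- exact: (integrableD measurableT iku1 iku2).
- exact: (integrableZl measurableT 2 integrable_heat_pairing).
rewrite integralD// integralZl//; last exact: integrable_heat_pairing.
rewrite ku1E ku2E.
rewrite -[X in (_ - 2%:E * X)%E]fineK; last exact: integrable_fin_num integrable_heat_pairing.
by rewrite -EFinM -!EFinD; congr EFin; rewrite /heat_pairing /Rintegral; ring.
Qed.

Hypothesis Iu : vol.-integrable setT (EFin \o u).

(** The kernel is bounded by its value at 0, so integrability of [u] makes the convolution converge
    at every point [z]. Functions in L^2 of the compact [Omega] satisfy it by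
    [restrict_integrable]. *)
Lemma integrable_heat_kernel_mul z : vol.-integrable setT (fun x => (k t (z - x) * u x)%:E).
Proof.
apply: le_integrable (integrableZl measurableT (k t 0) Iu) => //.
  by apply/measurable_EFinP; apply: measurable_funM => //; exact: measurable_heat_kernelB.
move=> x _ /=; rewrite lee_fin !normrM ler_wpM2r//.
by rewrite !ger0_norm ?heat_kernel_ge0// heat_kernel_le.
Qed.

Let iku : (vol \x vol)%E.-integrable setT (fun p => (k t (p.1 - p.2) * u p.2)%:E).
Proof.
have mf : measurable_fun setT
    (fun p : 'rV[R]_n * 'rV[R]_n => (k t (p.1 - p.2) * u p.2)%:E).
  by apply/measurable_EFinP; apply: measurable_funM.
apply/integrable21ltyP => //=.
have /integrableP[_] := Iu; apply: le_lt_trans.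
rewrite le_eqVlt; apply/orP; left; apply/eqP; apply: eq_integral => x _ /=.
under eq_integral do
  rewrite /= normrM (ger0_norm (heat_kernel_ge0 _ _)) mulrC EFinM heat_kernelB.
rewrite ge0_integralZl//; last 2 first.
- by apply/measurable_EFinP; exact: measurable_heat_kernelB.
- by move=> y _; rewrite lee_fin heat_kernel_ge0.
by rewrite integral_heat_kernelB// mule1.
Qed.

Let EFin_heat_apply z : ((heat_apply t u z)%:E = \int[vol]_x (k t (z - x) * u x)%:E)%E.
Proof. by rewrite fineK//; exact: integrable_fin_num (integrable_heat_kernel_mul z). Qed.

Lemma measurable_heat_apply : measurable_fun setT (heat_apply t u).
Proof.
apply/measurable_EFinP; rewrite (_ : _ \o _ = fubini_F vol
  (fun p : 'rV[R]_n * 'rV[R]_n => (k t (p.1 - p.2) * u p.2)%:E)); first exact: measurable_fubini_F iku.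
by apply/funext => z /=; rewrite EFin_heat_apply.
Qed.

Lemma heat_pairing_inner : heat_pairing t u = inner setT u (heat_apply t u).
Proof.
rewrite /heat_pairing /inner /Rintegral; congr fine.
rewrite -integral12_prod_meas1; last exact: integrable_heat_pairing.
apply: eq_integral => x _; rewrite /fubini_F /= EFinM EFin_heat_apply.
rewrite -integralZl//; last exact: integrable_heat_kernel_mul.
by apply: eq_integral => y _; rewrite -EFinM mulrCA.
Qed.

End fixed_function.

(** The square at [z] is a double integral over two copies of the variable; integrating over [z]
    first, the semigroup law leaves the kernel at time [2 t]. *)
Lemma integral_heat_apply_sqr t u : 0 < t -> square_integrable setT u ->
  vol.-integrable setT (EFin \o u) ->
  (\int[vol]_z (heat_apply t u z ^+ 2)%:E = (heat_pairing (2 * t) u)%:E)%E.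
Proof.
move=> t0 Lu Iu; have [mu _] := Lu.
have t20 : 0 < 2 * t by rewrite mulr_gt0.
pose f (q : 'rV[R]_n * ('rV[R]_n * 'rV[R]_n)) :=
  (k t (q.1 - q.2.1) * k t (q.1 - q.2.2) * (u q.2.1 * u q.2.2))%:E.
have mq1 : measurable_fun setT (fun q : 'rV[R]_n * ('rV[R]_n * 'rV[R]_n) => q.2.1).
  exact: measurableT_comp.
have mq2 : measurable_fun setT (fun q : 'rV[R]_n * ('rV[R]_n * 'rV[R]_n) => q.2.2).
  exact: measurableT_comp.
have mf : measurable_fun setT f.
  apply/measurable_EFinP; apply: measurable_funM; apply: measurable_funM.
  - exact: measurable_heat_kernelB.
  - exact: measurable_heat_kernelB.
  - exact: (measurableT_comp mu).
  - exact: (measurableT_comp mu).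
have zint (w : R) (p : 'rV[R]_n * 'rV[R]_n) :
    (\int[vol]_z (k t (z - p.1) * k t (z - p.2) * w)%:E =
     (k (2 * t) (p.1 - p.2) * w)%:E)%E.
  have K0 z : 0 <= k t (z - p.1) * k t (z - p.2) by rewrite mulr_ge0 ?heat_kernel_ge0.
  have IK : vol.-integrable setT (fun z => (k t (z - p.1) * k t (z - p.2))%:E).
    apply/integrableP; split.
      by apply/measurable_EFinP; apply: measurable_funM; exact: measurable_heat_kernelB.
    under eq_integral do rewrite gee0_abs ?lee_fin ?K0//.
    by rewrite heat_kernel_semigroup// ltry.
  under eq_integral do rewrite mulrC EFinM.
  by rewrite integralZl// heat_kernel_semigroup// -EFinM mulrC.
pose vol2 := @lebesgue_rV2 R n.
(* Absolute integrability in all three variables: integrating out [z] leaves the absolute value of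
   the integrand of [heat_pairing (2 * t) u]. *)
have If : (vol \x vol2)%E.-integrable setT f.
  apply/(@integrable21ltyP _ _ _ _ _ vol vol2 f) => //.
  have /integrableP[_] := integrable_heat_pairing t20 Lu.
  apply: le_lt_trans; rewrite le_eqVlt; apply/orP; left; apply/eqP.
  apply: eq_integral => p _; rewrite abse_EFin normrM (ger0_norm (heat_kernel_ge0 _ _)).
  rewrite -zint; apply: eq_integral => z _; rewrite /f abse_EFin normrM ger0_norm//.
  by rewrite mulr_ge0 ?heat_kernel_ge0.
transitivity (\int[vol]_z fubini_F vol2 f z)%E.
  apply: eq_integral => z _; rewrite /fubini_F /f /=.
  rewrite expr2 -integral_tensor; [|exact: integrable_heat_kernel_mul..].
  by apply: eq_integral => p _; rewrite mulrACA.
rewrite integral12_prod_meas1// -integral21_prod_meas1//.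
rewrite fineK; last exact: integrable_fin_num (integrable_heat_pairing t20 Lu).
by apply: eq_integral => p _; rewrite /fubini_G /f /= zint.
Qed.

Lemma square_integrable_heat_apply t u : 0 < t -> square_integrable setT u ->
  vol.-integrable setT (EFin \o u) -> square_integrable setT (heat_apply t u).
Proof.
move=> t0 Lu Iu; split; first exact: measurable_heat_apply.
by rewrite integral_heat_apply_sqr// ltry.
Qed.

Lemma heat_pairing_double t u : 0 < t -> square_integrable setT u ->
  vol.-integrable setT (EFin \o u) ->
  heat_pairing t u ^+ 2 <= inner setT u u * heat_pairing (2 * t) u.
Proof.
move=> t0 Lu Iu; rewrite heat_pairing_inner//.
have LK := square_integrable_heat_apply t0 Lu Iu.
apply: (le_trans (cauchy_schwarz_inner measurableT Lu LK)).
rewrite ler_wpM2l ?inner_ge0// -lee_fin EFin_inner//.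
by rewrite integral_heat_apply_sqr.
Qed.

End heat_semigroup.

Section heat_increment_lin.
Context {R : realType} {n : nat}.
Local Notation vol := (@lebesgue_rV R n).
Local Notation k := (@heat_kernel R n).

(** Isolated for the splitting of an eigenfunction into a test function [g] and an L^2-small
    remainder [w]. *)
Lemma heat_increment_le (t A B : R) (f g w : 'rV[R]_n -> R) : 0 <= A -> 0 <= B ->
  measurable_fun setT f -> measurable_fun setT g -> measurable_fun setT w ->
  (forall x y, (f (x + y) - f x) ^+ 2 <=
     A * (g (x + y) - g x) ^+ 2 + B * (w (x + y) - w x) ^+ 2) ->
  (heat_increment t f <= A%:E * heat_increment t g + B%:E * heat_increment t w)%E.
Proof.
move=> A0 B0 mf mg mw fgw.
pose H (h : 'rV[R]_n -> R) (p : 'rV[R]_n * 'rV[R]_n) :=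
  (k t p.1 * (h (p.2 + p.1) - h p.2) ^+ 2)%:E.
have mH h : measurable_fun setT h -> measurable_fun setT (H h).
  move=> mh; apply/measurable_EFinP; apply: measurable_funM.
    exact: measurable_heat_kernel.
  apply: measurable_funX; apply: measurable_funB; last exact: measurableT_comp.
  apply: (measurableT_comp mh); exact: measurable_addrV.
have H0 h p : (0 <= H h p)%E.
  by rewrite lee_fin mulr_ge0 ?heat_kernel_ge0 ?sqr_ge0.
have E h : measurable_fun setT h -> heat_increment t h = (\int[(vol \x vol)%E]_p H h p)%E.
  by move=> mh; rewrite fubini_tonelli1//; exact: mH.
rewrite !E// -!ge0_integralZl//; [|exact: mH..].
rewrite -ge0_integralD//; last 4 first.
- by move=> p _; rewrite mule_ge0.
- by apply: measurable_funeM; exact: mH.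
- by move=> p _; rewrite mule_ge0.
- by apply: measurable_funeM; exact: mH.
apply: ge0_le_integral => //.
- exact: mH.
- by apply: emeasurable_funD; apply: measurable_funeM; exact: mH.
move=> p _; rewrite /H -!EFinM -EFinD lee_fin.
have := ler_wpM2l (heat_kernel_ge0 t p.1) (fgw p.2 p.1).
by rewrite mulrDr !(mulrCA (k t p.1)).
Qed.

End heat_increment_lin.

(** * Bessel's inequality and the sum of the Gaussian pairings *)

Section bessel.
Context {R : realType} {n : nat}.
Variable D : set 'rV[R]_n.
Hypothesis mD : measurable D.
Local Notation L2 := (square_integrable D).

Lemma bessel_inner (I : finType) (u : I -> 'rV[R]_n -> R) f :
  (forall i, L2 (u i)) -> (forall i j, inner D (u i) (u j) = (i == j)%:R) -> L2 f ->
  \sum_i inner D f (u i) ^+ 2 <= inner D f f.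
Proof.
move=> Lu ou Lf; set c := fun i => inner D f (u i).
pose g x := \sum_i c i * u i x.
have Lcu i : L2 (fun x => c i * u i x) by exact: square_integrableZ.
have Lg : L2 g by exact: square_integrable_sum.
have fg : inner D f g = \sum_i c i ^+ 2.
  rewrite innerC inner_suml//; apply: eq_bigr => i _.
  by rewrite innerZl// innerC expr2.
have gg : inner D g g = \sum_i c i ^+ 2.
  rewrite {1}/g inner_suml//; apply: eq_bigr => i _.
  rewrite innerZl// expr2; congr (_ * _); rewrite innerC inner_suml//.
  rewrite (bigD1 i)//= innerZl// ou eqxx mulr1 big1 ?addr0// => j ji.
  by rewrite innerZl// ou (negbTE ji) mulr0.
have := inner_ge0 D (f \- g).
rewrite innerBl ?innerBr//; last exact: square_integrableB.
by rewrite (innerC D g f) fg gg; lra.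
Qed.

End bessel.

Section heat_trace_of_family.
Context {R : realType} {n : nat}.
Local Notation vol := (@lebesgue_rV R n).
Local Notation k := (@heat_kernel R n).
Variable Omega : set 'rV[R]_n.
Hypothesis cOmega : compact Omega.
Local Notation L2 := (square_integrable Omega).

Let mOmega : measurable Omega.
Proof. exact: compact_rV_measurable. Qed.

Lemma lebesgue_compact_lty : (vol Omega < +oo)%E.
Proof.
have [r _ hr] := compact_rV_bounded cOmega.
apply: (le_lt_trans _ (@lebesgue_cball0 R n r)); apply: le_measure; rewrite ?inE//.
by apply: closed_rV_measurable; exact: closed_cball0.
Qed.

(** On a set of finite volume, [|u| <= 1 + u^2] passes from L^2 to L^1. *)
Lemma restrict_integrable u : L2 u -> vol.-integrable setT (EFin \o (u \_ Omega)).
Proof.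
move=> Lu; have Lu' := square_integrable_restrict mOmega Lu.
have iO : vol.-integrable setT (fun x => (\1_Omega x)%:E).
  apply/integrableP; split; first by apply/measurable_EFinP; exact: measurable_indic.
  under eq_integral do rewrite gee0_abs ?lee_fin//.
  by rewrite integral_indic// setIT lebesgue_compact_lty.
have I2 := integrableD measurableT iO (integrable_sqr Lu').
apply: (@le_integrable _ _ _ vol setT measurableT _ _ _ _ I2).
  by apply/measurable_EFinP; case: Lu'.
move=> x _ /=; rewrite lee_fin patchE indicE; case: ifPn => xO; last by rewrite normr0.
apply: le_trans (ler_norm _); have := sqr_ge0 (`|u x| - 1).
have : `|u x| ^+ 2 = u x ^+ 2 by rewrite real_normK ?num_real.
rewrite ?patchE ?xO /=; nra.
Qed.

Lemma heat_pairing_sum_le (I : finType) (u : I -> 'rV[R]_n -> R) (t : R) : 0 < t ->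
  (forall i, L2 (u i)) ->
  (forall i j, inner Omega (u i) (u j) = (i == j)%:R) ->
  ((\sum_i heat_pairing t (u i \_ Omega))%:E <= vol Omega * (k t 0)%:E)%E.
Proof.
move=> t0 Lu ou; pose s := t / 2.
have s0 : 0 < s by rewrite divr_gt0.
have -> : t = 2 * s by rewrite /s; lra.
have mk2 : measurable_fun setT
   (fun p : 'rV[R]_n * 'rV[R]_n => (k s (p.1 - p.2) * k s (p.1 - p.2) * \1_Omega p.2)%:E).
  apply/measurable_EFinP; apply: measurable_funM.
    by apply: measurable_funM; exact: measurable_heat_kernelB.
  by apply: measurableT_comp => //; exact: measurable_indic.
have k20 (p : 'rV[R]_n * 'rV[R]_n) : (0 <= (k s (p.1 - p.2) * k s (p.1 - p.2) * \1_Omega p.2)%:E)%E.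
  by rewrite lee_fin mulr_ge0// mulr_ge0 ?heat_kernel_ge0.
have Lk z : L2 (fun x => k s (z - x)).
  have mkz : measurable_fun setT (fun x : 'rV[R]_n => k s (z - x)) by exact: measurable_heat_kernelB.
  split; first exact: measurable_funS mkz.
  apply: (@le_lt_trans _ _ (\int[vol]_(x in Omega) (k s 0 ^+ 2)%:E)%E).
    apply: ge0_le_integral => //.
    - by move=> x _; rewrite lee_fin sqr_ge0.
    - by apply/measurable_EFinP; apply: measurable_funX; exact: measurable_funS mkz.
    - by move=> x _; rewrite lee_fin ler_sqr ?nnegrE ?heat_kernel_ge0// heat_kernel_le.
  by rewrite integral_cst//= lte_mul_pinfty ?lee_fin ?sqr_ge0// lebesgue_compact_lty.
have Lr i := square_integrable_restrict mOmega (Lu i).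
have Ir i := restrict_integrable (Lu i).
have mh i := measurable_heat_apply s0 (Lr i) (Ir i).
rewrite -sumEFin.
under eq_bigr do rewrite -integral_heat_apply_sqr//.
rewrite -ge0_integral_sum//; last 2 first.
- by move=> i; apply/measurable_EFinP; apply: measurable_funX.
- by move=> i z _; rewrite lee_fin sqr_ge0.
apply: (@le_trans _ _ (\int[vol]_z \int[vol]_x
   (k s (z - x) * k s (z - x) * \1_Omega x)%:E)%E).
  apply: ge0_le_integral => //.
  - by move=> z _; apply: sume_ge0 => i _; rewrite lee_fin sqr_ge0.
  - by apply: emeasurable_sum => i; apply/measurable_EFinP; apply: measurable_funX.
  - exact: (@measurable_fun_fubini_tonelli_F _ _ _ _ _ vol _ mk2 k20).
  move=> z _; rewrite sumEFin.
  have -> : (\int[vol]_x (k s (z - x) * k s (z - x) * \1_Omega x)%:E =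
      (inner Omega (fun x => k s (z - x)) (fun x => k s (z - x)))%:E)%E.
    rewrite EFin_inner// [RHS]integral_mkcond; apply: eq_integral => x _.
    by rewrite patchE indicE; case: ifPn; rewrite ?mulr1 ?mulr0// expr2.
  (* The value at [z] of the convolution with [u i] is the Bessel coefficient of [k s (z - .)]
     against [u i]. *)
  rewrite lee_fin; apply: le_trans (bessel_inner mOmega Lu ou (Lk z)).
  rewrite le_eqVlt; apply/orP; left; apply/eqP; apply: eq_bigr => i _.
  congr (_ ^+ 2); rewrite /heat_apply /inner [RHS]Rintegral_mkcond.
  apply: eq_Rintegral => x _.
  by rewrite !patchE; case: ifPn; rewrite // mulr0.
(* Integrating over [z] first, each [x] in [Omega] contributes [k (2 * s) (x - x)] by the semigroup
   law. *)
rewrite (@fubini_tonelli _ _ _ _ _ vol vol _ mk2 k20)/=.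
have -> : vol Omega = (\int[vol]_x (\1_Omega x)%:E)%E by rewrite integral_indic// setIT.
rewrite muleC -ge0_integralZl//; last 2 first.
- by apply/measurable_EFinP; exact: measurable_indic.
- by rewrite lee_fin heat_kernel_ge0.
rewrite le_eqVlt; apply/orP; left; apply/eqP; apply: eq_integral => x _.
under eq_integral do rewrite mulrC EFinM.
rewrite ge0_integralZl//; last 2 first.
- by apply/measurable_EFinP; apply: measurable_funM; exact: measurable_heat_kernelB.
- by move=> y _; rewrite lee_fin mulr_ge0 ?heat_kernel_ge0.
by rewrite heat_kernel_semigroup// subrr muleC.
Qed.

End heat_trace_of_family.

(** * Dirichlet eigenfunctions *)

Section inner_estimates.
Context {R : realType} {n : nat}.
Variable D : set 'rV[R]_n.
Hypothesis mD : measurable D.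
Local Notation L2 := (square_integrable D).
Implicit Types u v g : 'rV[R]_n -> R.

Lemma inner_lin_sqr (c : R) u v : L2 u -> L2 v ->
  inner D (fun x => c * u x + v x) (fun x => c * u x + v x) =
  c ^+ 2 * inner D u u + 2 * c * inner D u v + inner D v v.
Proof.
move=> Lu Lv; have L := square_integrable_lin mD c Lu Lv.
by rewrite inner_linl// !inner_linr// (innerC D v u); ring.
Qed.

Lemma inner_lin_sqr_le (c : R) u v : L2 u -> L2 v ->
  inner D (fun x => c * u x + v x) (fun x => c * u x + v x) <=
  2 * c ^+ 2 * inner D u u + 2 * inner D v v.
Proof.
move=> Lu Lv; rewrite inner_lin_sqr//.
have := inner_ge0 D (fun x => (- c) * u x + v x).
by rewrite inner_lin_sqr// sqrrN; lra.
Qed.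

Lemma inner_cvg u (phi : nat -> 'rV[R]_n -> R) g :
  L2 u -> (forall k, L2 (phi k)) -> L2 g ->
  (fun k => inner D (u \- phi k) (u \- phi k)) @ \oo --> (0 : R) ->
  inner D (phi k) g @[k --> \oo] --> inner D u g.
Proof.
move=> Lu Lphi Lg h.
apply/cvgrPdist_lt => e e0.
have e1 : 0 < e ^+ 2 / (inner D g g + 1).
  by rewrite divr_gt0 ?exprn_gt0// ltr_wpDl ?inner_ge0.
have /cvgrPdist_lt/(_ _ e1) := h.
apply: filterS => k; rewrite sub0r normrN ger0_norm ?inner_ge0// => hk.
have Luk := square_integrableB mD Lu (Lphi k).
rewrite -innerBl// -(@ltr_pXn2r _ 2) ?nnegrE//; last exact: ltW.
rewrite real_normK ?num_real//.
apply: le_lt_trans (cauchy_schwarz_inner mD Luk Lg) _.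
have g0 := inner_ge0 D g.
move: hk; rewrite ltr_pdivlMr; last by rewrite ltr_wpDl.
by apply: le_lt_trans; rewrite ler_wpM2l ?inner_ge0// lerDl.
Qed.

End inner_estimates.

Section eigenfunctions.
Context {R : realType} {n : nat}.
Local Notation vol := (@lebesgue_rV R n).
Variable Omega : set 'rV[R]_n.
Hypothesis cOmega : compact Omega.
Local Notation L2 := (square_integrable Omega).
Local Notation test := (test_function Omega).
Local Notation q := (@dirichlet_form R n).
Implicit Types u v phi psi : 'rV[R]_n -> R.

Let mOmega : measurable Omega.
Proof. exact: compact_rV_measurable. Qed.

Let testL2 phi : test phi -> L2 phi.
Proof. exact: test_function_square_integrable_in. Qed.

Let L2_partial phi i : test phi -> square_integrable setT (partial i phi).
Proof.
move=> tp; apply: (test_function_square_integrable cOmega).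
exact: test_function_partial.
Qed.

Lemma dirichlet_form_ge0 phi : 0 <= q phi phi.
Proof. by rewrite dirichlet_form.unlock; apply: sumr_ge0 => i _; exact: inner_ge0. Qed.

Lemma dirichlet_form_linl (c : R) phi phi' psi : test phi -> test phi' -> test psi ->
  q (fun x => c * phi x + phi' x) psi = c * q phi psi + q phi' psi.
Proof.
move=> tp tp' tq; rewrite dirichlet_form.unlock mulr_sumr -big_split.
apply: eq_bigr => i _ /=; rewrite partial_lin; [|by case: tp|by case: tp'].
by rewrite inner_linl//; exact: L2_partial.
Qed.

Lemma dirichlet_form_linr (c : R) phi phi' psi : test phi -> test phi' -> test psi ->
  q psi (fun x => c * phi x + phi' x) = c * q psi phi + q psi phi'.
Proof. by move=> tp tp' tq; rewrite !(dirichlet_formC psi) dirichlet_form_linl. Qed.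

Lemma dirichlet_form_lin_sqr (c : R) phi psi : test phi -> test psi ->
  q (fun x => c * phi x + psi x) (fun x => c * phi x + psi x) =
  c ^+ 2 * q phi phi + 2 * c * q phi psi + q psi psi.
Proof.
move=> tp tq; have t := test_function_lin c tp tq.
rewrite (dirichlet_form_linl c tp tq t) (dirichlet_form_linr c tp tq tp).
rewrite (dirichlet_form_linr c tp tq tq).
rewrite (dirichlet_formC psi phi).
move: (q phi phi) (q phi psi) (q psi psi) => a b d.
ring.
Qed.

Lemma dirichlet_formBl phi phi' psi : test phi -> test phi' -> test psi ->
  q (phi \- phi') psi = q phi psi - q phi' psi.
Proof.
move=> tp tp' tq.
have -> : phi \- phi' = (fun x => -1 * phi' x + phi x).
  by apply/funext => x /=; rewrite mulN1r addrC.
rewrite (dirichlet_form_linl (-1) tp' tp tq).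
by move: (q phi psi) (q phi' psi) => a b; ring.
Qed.

Lemma dirichlet_form_le2 (c : R) phi psi : test phi -> test psi ->
  q (fun x => c * phi x + psi x) (fun x => c * phi x + psi x) <=
  2 * c ^+ 2 * q phi phi + 2 * q psi psi.
Proof.
move=> tp tq; rewrite (dirichlet_form_lin_sqr c tp tq).
have := dirichlet_form_ge0 (fun x => (- c) * phi x + psi x).
rewrite (dirichlet_form_lin_sqr (- c) tp tq) sqrrN.
by move: (q phi phi) (q phi psi) (q psi psi) => a b d; lra.
Qed.

(** Nonnegativity of the form at [s * phi + psi] and [- s * phi + psi]. The free weight serves where
    one factor is small and the other merely bounded. *)
Lemma dirichlet_form_cauchy (s : R) phi psi : 0 < s -> test phi -> test psi ->
  2 * `|q phi psi| <= s * q phi phi + s^-1 * q psi psi.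
Proof.
move=> s0 tp tq.
have h c : 0 <= c ^+ 2 * q phi phi + 2 * c * q phi psi + q psi psi.
  rewrite -(dirichlet_form_lin_sqr c tp tq); exact: dirichlet_form_ge0.
move: (q phi phi) (q phi psi) (q psi psi) h => a b d h.
have si : s * s^-1 = 1 by rewrite mulfV// gt_eqF.
rewrite -(ler_pM2l s0) mulrDr !mulrA si mul1r.
have := h s; have := h (- s); rewrite sqrrN => h1 h2.
by case: (ger0P b) => b0; lra.
Qed.

Lemma inner_neg_laplacian phi psi : test phi -> test psi ->
  inner Omega (neg_laplacian phi) psi = q phi psi.
Proof.
move=> tp tq; rewrite inner_test_test//; last exact: neg_laplacian_test.
exact: (neg_laplacian_dirichlet cOmega tp tq).
Qed.

(** The approximating sequence of [form_domain], with the form expressed through gradients. *)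
Definition form_approx u (phi : nat -> 'rV[R]_n -> R) :=
  [/\ forall k, test (phi k),
      (fun k => inner Omega (u \- phi k) (u \- phi k)) @ \oo --> (0 : R) &
      forall e : R, 0 < e -> exists N : nat, forall j k : nat,
        (N <= j)%N -> (N <= k)%N -> q (phi j \- phi k) (phi j \- phi k) < e].

Lemma form_domainP u : form_domain Omega u <-> L2 u /\ exists phi : nat -> 'rV[R]_n -> R, form_approx u phi.
Proof.
have E (phi : nat -> 'rV[R]_n -> R) j k : (forall k, test (phi k)) ->
    inner Omega (neg_laplacian (phi j \- phi k)) (phi j \- phi k) =
    q (phi j \- phi k) (phi j \- phi k).
  by move=> tp; rewrite inner_neg_laplacian//; exact: test_functionB.
split=> -[Lu [phi [tp cp hp]]]; split => //; exists phi; split => // e /hp[N hN];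
  exists N => j k Nj Nk; first by rewrite -E// hN.
by rewrite E// hN.
Qed.

Lemma form_approx_bounded u (phi : nat -> 'rV[R]_n -> R) : form_approx u phi ->
  exists M : R, exists N : nat, 0 <= M /\ forall k, (N <= k)%N -> q (phi k) (phi k) <= M.
Proof.
move=> [tp _ /(_ 1 ltr01)[N hN]].
exists (2 + 2 * q (phi N) (phi N)), N; split.
  by have := dirichlet_form_ge0 (phi N); lra.
move=> k Nk; have := hN k N Nk (leqnn N).
have := dirichlet_form_le2 1 (test_functionB (tp k) (tp N)) (tp N).
have -> : (fun x => 1 * (phi k \- phi N) x + phi N x) = phi k.
  by apply/funext => x /=; rewrite mul1r subrK.
by rewrite expr1n mulr1; lra.
Qed.

(* Both the energy of an eigenfunction and the orthogonality of eigenfunctions for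
   distinct eigenvalues are instances of this limit. *)
Lemma form_approx_pairing (l : R) u v (phi psi : nat -> 'rV[R]_n -> R) :
  eigenfunction Omega l u -> L2 v -> form_approx u phi -> form_approx v psi ->
  forall e : R, 0 < e -> exists N : nat, forall j k, (N <= j)%N -> (N <= k)%N ->
    `|q (phi j) (psi k) - l * inner Omega u v| < e.
Proof.
move=> [/form_domainP[Lu _] _ weak] Lv ap aq e e0.
have [M [N0 [M0 hM]]] := form_approx_bounded aq.
have [tp cp Cp] := ap; have [tq cq _] := aq.
(* The three errors below are at most [d (1 + M) / 2], [d] and [d], together less than
   [d (M + 4) = e]. *)
pose d := e / (M + 4).
have d0 : 0 < d by rewrite divr_gt0//; lra.
have [N1 hN1] := Cp _ (exprn_gt0 2 d0).
have /cvgrPdist_lt cq' : l * inner Omega (psi k) u @[k --> \oo] --> l * inner Omega v u.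
  apply: cvgM; first exact: cvg_cst.
  by apply: inner_cvg => // k; exact: testL2.
have [N2 _ hN2] := cq' _ d0.
exists (maxn N0 (maxn N1 N2)) => j k; rewrite !geq_max.
move=> /and3P[_ jN1 _] /and3P[kN0 kN1 kN2].
(* As [psi k] is a test function, the weak eigenvalue equation for [u] identifies the limit in
   [i]. *)
have lim : q (phi i) (psi k) @[i --> \oo] --> l * inner Omega u (psi k).
  have -> : l * inner Omega u (psi k) = inner Omega u (neg_laplacian (psi k)).
    by rewrite -weak// innerZl//; exact: testL2.
  have -> : (fun i => q (phi i) (psi k)) = (fun i => inner Omega (phi i) (neg_laplacian (psi k))).
    by apply/funext => i; rewrite innerC inner_neg_laplacian// dirichlet_formC.
  apply: inner_cvg => //; first by move=> i; exact: testL2.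
  by apply: testL2; exact: neg_laplacian_test.
have /cvgrPdist_lt/(_ _ d0)[N3 _ hN3] := lim.
pose i := maxn N1 N3.
have h3 : `|l * inner Omega u (psi k) - q (phi i) (psi k)| < d.
  by apply: hN3; rewrite /= leq_maxr.
have h2 : `|l * inner Omega v u - l * inner Omega (psi k) u| < d by exact: hN2.
(* The weight [d^-1] balances the Cauchy bound [d^2] on the difference of the [phi] against the
   bound [M] on [psi k]. *)
have h1 : `|q (phi j) (psi k) - q (phi i) (psi k)| <= d * (1 + M) / 2.
  rewrite -dirichlet_formBl//.
  have di : 0 < d^-1 by rewrite invr_gt0.
  have := dirichlet_form_cauchy di (test_functionB (tp j) (tp i)) (tq k).
  rewrite invrK => h.
  have hA : d^-1 * q (phi j \- phi i) (phi j \- phi i) <= d.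
    rewrite mulrC ler_pdivrMr// -expr2; apply/ltW/hN1 => //.
    by rewrite leq_maxl.
  have hB : d * q (psi k) (psi k) <= d * M by rewrite ler_wpM2l ?hM// ltW.
  lra.
rewrite (innerC _ u v).
have eE : e = d * (M + 4) by rewrite /d; field; lra.
move: h1 h2 h3; rewrite (innerC _ u (psi k)).
have M1 : 0 <= d * M by rewrite mulr_ge0// ltW.
rewrite eE !ltr_norml ler_norml => /andP[? ?] /andP[? ?] /andP[? ?].
by apply/andP; split; lra.
Qed.

End eigenfunctions.

(** * Orthogonality of eigenspaces and the lower bound on pairings *)

Section eigenfunction_heat.
Context {R : realType} {n : nat}.
Local Notation vol := (@lebesgue_rV R n).
Variable Omega : set 'rV[R]_n.
Hypothesis cOmega : compact Omega.
Local Notation L2 := (square_integrable Omega).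
Local Notation test := (test_function Omega).
Local Notation q := (@dirichlet_form R n).
Local Notation eigen := (eigenfunction Omega).
Implicit Types u v phi psi : 'rV[R]_n -> R.

Let mOmega : measurable Omega.
Proof. exact: compact_rV_measurable. Qed.

Let testL2 phi : test phi -> L2 phi.
Proof. exact: test_function_square_integrable_in. Qed.

Lemma eigenfunction_square_integrable (l : R) u : eigen l u -> L2 u.
Proof. by case=> -[]. Qed.

(** The weak equation for [u] admits only test functions, not [v] itself. Along the two
    approximating sequences the symmetric form is close to both [l <u, v>] and [m <u, v>], which
    must therefore agree. *)
Lemma eigenfunction_orthogonal (l m : R) u v : eigen l u -> eigen m v -> l != m ->
  inner Omega u v = 0.
Proof.
move=> eu ev lm; have Lu := eigenfunction_square_integrable eu.
have Lv := eigenfunction_square_integrable ev.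
have [/(form_domainP cOmega)[_ [phi ap]] _ _] := eu.
have [/(form_domainP cOmega)[_ [psi aq]] _ _] := ev.
suff : `|(l - m) * inner Omega u v| <= 0.
  by rewrite normr_le0 mulf_eq0 subr_eq0 (negbTE lm) => /eqP.
apply/ler_addgt0Pr => e e0; rewrite add0r.
have e2 : 0 < e / 2 by rewrite divr_gt0.
have [N1 h1] := form_approx_pairing cOmega eu Lv ap aq e2.
have [N2 h2] := form_approx_pairing cOmega ev Lu aq ap e2.
pose k := maxn N1 N2.
have := h1 k k (leq_maxl _ _) (leq_maxl _ _).
have := h2 k k (leq_maxr _ _) (leq_maxr _ _).
rewrite dirichlet_formC (innerC Omega v u) mulrBl ler_norml !ltr_norml.
by move=> /andP[? ?] /andP[? ?]; apply/andP; split; lra.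
Qed.

Lemma eigenfunction_approx (l : R) u : eigen l u -> forall e : R, 0 < e ->
  exists phi, [/\ test phi, inner Omega (u \- phi) (u \- phi) < e &
    q phi phi < l * inner Omega u u + e].
Proof.
move=> eu e e0; have Lu := eigenfunction_square_integrable eu.
have [/(form_domainP cOmega)[_ [phi ap]] _ _] := eu.
have [N1 h1] := form_approx_pairing cOmega eu Lu ap ap e0.
have [tp /cvgrPdist_lt/(_ _ e0)[N2 _ h2] _] := ap.
pose k := maxn N1 N2.
exists (phi k); split => //.
  by have := h2 k (leq_maxr _ _); rewrite sub0r normrN; apply: le_lt_trans; exact: ler_norm.
have := h1 k k (leq_maxl _ _) (leq_maxl _ _); rewrite ltr_norml => /andP[_].
by rewrite ltrBlDl.
Qed.

(** A pairing at time [t] is the squared norm of the convolution at time [t / 2]. This bounds the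
    increment of any function by twice its squared L^2 norm. *)
Lemma heat_pairing_ge0 (t : R) u : 0 < t -> L2 u -> 0 <= heat_pairing t (u \_ Omega).
Proof.
move=> t0 Lu; rewrite (_ : t = 2 * (t / 2)); last by lra.
have t2 : 0 < t / 2 by rewrite divr_gt0.
rewrite -lee_fin -(integral_heat_apply_sqr t2); last 2 first.
- exact: square_integrable_restrict.
- exact: restrict_integrable.
by apply: integral_ge0 => z _; rewrite lee_fin sqr_ge0.
Qed.

(** The gradient bound is applied to a test function [phi] near [u]; the remainder [u - phi] is
    controlled by its L^2 norm alone. A Young weight [s] keeps the factor of the main term close to
    1. *)
Lemma eigenfunction_heat_increment (l t : R) u : 0 < t -> eigen l u ->
  (heat_increment t (u \_ Omega) <= (2 * t * (l * inner Omega u u))%:E)%E.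
Proof.
move=> t0 eu; have Lu := eigenfunction_square_integrable eu.
have Lr := square_integrable_restrict mOmega Lu.
have [mr _] := Lr.
rewrite (heat_incrementE t0 Lr) lee_fin.
set X := 2 * _ - _; set b := l * inner Omega u u.
have key (s e : R) : 0 < s -> 0 < e ->
    X <= (1 + s) * (2 * t * (b + e)) + (1 + s^-1) * (2 * e).
  move=> s0 e0; have [phi [tp ue qe]] := eigenfunction_approx eu e0.
  have Lw := square_integrableB mOmega Lu (testL2 tp).
  have Lwr := square_integrable_restrict mOmega Lw.
  have [mw _] := Lwr.
  have mp : measurable_fun setT phi.
    by apply: cc_fun_measurable; exact: test_function_cc tp.
  have si : s * s^-1 = 1 by rewrite mulfV// gt_eqF.
  have si0 : 0 < s^-1 by rewrite invr_gt0.
  have uE x : (u \_ Omega) x = phi x + ((u \- phi) \_ Omega) x.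
    rewrite -{1}(test_function_restrict tp) !patchE; case: ifPn => _ /=.
      by rewrite addrC subrK.
    by rewrite addr0.
  have A0 : 0 <= 1 + s by lra.
  have B0 : 0 <= 1 + s^-1 by lra.
  have young x y : ((u \_ Omega) (x + y) - (u \_ Omega) x) ^+ 2 <=
      (1 + s) * (phi (x + y) - phi x) ^+ 2 + (1 + s^-1) *
      (((u \- phi) \_ Omega) (x + y) - ((u \- phi) \_ Omega) x) ^+ 2.
    rewrite !uE.
    set a := phi (x + y); set a' := phi x.
    set c := ((u \- phi) \_ Omega) (x + y); set c' := ((u \- phi) \_ Omega) x.
    have h : 0 <= s^-1 * (s * (a - a') - (c - c')) ^+ 2 by rewrite mulr_ge0 ?sqr_ge0// ltW.
    rewrite -subr_ge0.
    suff -> : (1 + s) * (a - a') ^+ 2 + (1 + s^-1) * (c - c') ^+ 2 -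
      (a + c - (a' + c')) ^+ 2 = s^-1 * (s * (a - a') - (c - c')) ^+ 2 by [].
    by field; rewrite gt_eqF.
  have : ((X)%:E <= (1 + s)%:E * (2 * t * (b + e))%:E + (1 + s^-1)%:E * (2 * e)%:E)%E.
    rewrite /X -(heat_incrementE t0 Lr).
    apply: (le_trans (heat_increment_le t A0 B0 mr mp mw young)).
    apply: leeD; apply: lee_wpmul2l; rewrite ?lee_fin//.
      apply: (le_trans (test_function_heat_increment cOmega t0 tp)).
      by rewrite lee_fin ler_wpM2l ?mulr_ge0// ltW.
    rewrite (heat_incrementE t0 Lwr) lee_fin inner_restrict//.
    by have := heat_pairing_ge0 t0 Lw; lra.
  by rewrite -!EFinM -EFinD lee_fin.
rewrite leNgt; apply/negP => bX.
(* To refute an excess [d], choose [s] so that the factor [1 + s] costs at most [d / 2], then [e] so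
   that the remaining error is [d / 4]. The absolute value in [c] covers either sign of [b]. *)
pose d := X - 2 * t * b; have d0 : 0 < d by rewrite subr_gt0.
pose c := `|2 * t * b| + 1.
have c0 : 0 < c by rewrite ltr_wpDl.
pose s := d / (2 * c); have s0 : 0 < s by rewrite divr_gt0// mulr_gt0.
pose K := (1 + s) * (2 * t) + (1 + s^-1) * 2.
have K0 : 0 < K.
  have : 0 < s^-1 by rewrite invr_gt0.
  by move=> ?; rewrite addr_gt0// !mulr_gt0//; lra.
pose e := d / (4 * K); have e0 : 0 < e by rewrite divr_gt0// mulr_gt0.
have := key s e s0 e0.
have -> : (1 + s) * (2 * t * (b + e)) + (1 + s^-1) * (2 * e) =
  2 * t * b + s * (2 * t * b) + K * e by rewrite /K; ring.
have -> : K * e = d / 4 by rewrite /e; field; rewrite gt_eqF.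
have : s * (2 * t * b) <= d / 2.
  apply: (@le_trans _ _ (s * c)).
    by rewrite ler_wpM2l ?ltW// /c; have := ler_norm (2 * t * b); lra.
  by rewrite le_eqVlt; apply/orP; left; apply/eqP; rewrite /s; field; rewrite gt_eqF.
by move: d0; rewrite /d; lra.
Qed.

(** Makes the eigenspace closed under the operations of Gram-Schmidt. *)
Lemma eigenfunction_lin (l c : R) u v : eigen l u -> eigen l v ->
  eigen l (fun x => c * u x + v x).
Proof.
move=> eu ev.
have [/(form_domainP cOmega)[Lu [phi [tp cp Cp]]] _ wu] := eu.
have [/(form_domainP cOmega)[Lv [psi [tq cq Cq]]] _ wv] := ev.
have L := square_integrable_lin mOmega c Lu Lv.
split; first apply/(form_domainP cOmega); first split => //.
- exists (fun k x => c * phi k x + psi k x); split.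
  + by move=> k; exact: test_function_lin.
  + have Lup k := square_integrableB mOmega Lu (testL2 (tp k)).
    have Lvq k := square_integrableB mOmega Lv (testL2 (tq k)).
    pose g k := 2 * c ^+ 2 * inner Omega (u \- phi k) (u \- phi k) +
               2 * inner Omega (v \- psi k) (v \- psi k).
    have g0 : g k @[k --> \oo] --> (0 : R).
      rewrite -[X in _ --> X](_ : 2 * c ^+ 2 * 0 + 2 * 0 = 0); last by ring.
      by apply: cvgD; apply: cvgM => //; exact: cvg_cst.
    apply: (squeeze_cvgr _ (cvg_cst 0) g0); apply: nearW => k.
    rewrite inner_ge0 /=.
    apply: le_trans (inner_lin_sqr_le mOmega c (Lup k) (Lvq k)).
    rewrite le_eqVlt; apply/orP; left; apply/eqP.
    by congr inner; apply/funext => x /=; ring.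
  + move=> e e0.
    (* Thresholds chosen so that [2 c^2] times the first plus twice the second is at most [e]. *)
    have c1 : 0 < 4 * (c ^+ 2 + 1) by rewrite mulr_gt0// ltr_wpDl ?sqr_ge0.
    have ec : 0 < e / (4 * (c ^+ 2 + 1)) by rewrite divr_gt0.
    have e4 : 0 < e / 4 by rewrite divr_gt0.
    have [N1 h1] := Cp _ ec; have [N2 h2] := Cq _ e4.
    exists (maxn N1 N2) => j k; rewrite !geq_max => /andP[j1 j2] /andP[k1 k2].
    have tpjk := test_functionB (tp j) (tp k).
    have tqjk := test_functionB (tq j) (tq k).
    apply: le_lt_trans (_ : 2 * c ^+ 2 * q (phi j \- phi k) (phi j \- phi k)
       + 2 * q (psi j \- psi k) (psi j \- psi k) < _).
      apply: le_trans (dirichlet_form_le2 cOmega c tpjk tqjk).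
      rewrite le_eqVlt; apply/orP; left; apply/eqP.
      by congr q; apply/funext => x /=; ring.
    have := h1 j k j1 k1; rewrite ltr_pdivlMr//.
    have := h2 j k j2 k2.
    by have := dirichlet_form_ge0 (phi j \- phi k); lra.
- exact: square_integrableZ.
move=> psi' tq'; have Lt := testL2 tq'.
have Ln : L2 (neg_laplacian psi') by apply: testL2; exact: neg_laplacian_test.
rewrite inner_linl// innerZl// inner_linl//.
by rewrite -wu// -wv// !innerZl//; ring.
Qed.

Lemma heat_pairing_pow (t y : R) u m : 0 < t -> L2 u -> inner Omega u u = 1 ->
  0 <= y -> y <= heat_pairing t (u \_ Omega) ->
  y ^+ (2 ^ m) <= heat_pairing (2 ^+ m * t) (u \_ Omega).
Proof.
move=> t0 Lu nu y0 hy; elim: m => [|m ih]; first by rewrite expr0 mul1r expr1.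
have t1 : 0 < 2 ^+ m * t by rewrite mulr_gt0// exprn_gt0.
have H := heat_pairing_double t1 (square_integrable_restrict mOmega Lu)
  (restrict_integrable cOmega Lu).
rewrite inner_restrict nu mul1r in H.
rewrite exprS -mulrA; apply: le_trans H.
rewrite expnS mulnC exprM.
by apply: lerXn2r; rewrite ?nnegrE ?exprn_ge0// (le_trans _ ih)// exprn_ge0.
Qed.

Lemma eigenfunction_heat_pairing (l t : R) u : 0 < t -> eigen l u ->
  inner Omega u u = 1 -> expR (- l * t) <= heat_pairing t (u \_ Omega).
Proof.
move=> t0 eu nu; have Lu := eigenfunction_square_integrable eu.
pose y m := l * (2 ^- m * t).
have y0 : y m @[m --> \oo] --> (0 : R).
  rewrite -[X in _ --> X](mulr0 l); apply: cvgM; first exact: cvg_cst.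
  rewrite -[X in _ --> X](mul0r t); apply: cvgM; last exact: cvg_cst.
  under eq_fun do rewrite -exprVn.
  by apply: cvg_expr; rewrite ger0_norm; lra.
(* From [1 / (1 - y) = 1 + y / (1 - y) <= e^(y / (1 - y))], the power [(1 - y m)^(2^m)] is at least
   [e^(- l t / (1 - y m))]; its limit then only involves continuity of the exponential. *)
have lim : expR (- (l * t) / (1 - y m)) @[m --> \oo] --> expR (- l * t).
  apply: continuous_cvg; first exact: continuous_expR.
  rewrite -[X in _ --> X](_ : - (l * t) * (1 - 0)^-1 = _); last first.
    by rewrite subr0 invr1 mulr1 mulNr.
  apply: cvgM; first exact: cvg_cst.
  apply: cvgV; first by rewrite subr0 oner_neq0.
  by apply: cvgB => //; exact: cvg_cst.
apply: (cvgr_to_le lim).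
have /cvgrPdist_lt/(_ _ ltr01) := y0.
apply: filterS => m; rewrite sub0r normrN ltr_norml => /andP[_ ym].
have tm : 0 < 2 ^- m * t by rewrite mulr_gt0// invr_gt0 exprn_gt0.
have ty : 1 - y m <= heat_pairing (2 ^- m * t) (u \_ Omega).
  have := eigenfunction_heat_increment tm eu.
  rewrite (heat_incrementE tm (square_integrable_restrict mOmega Lu)).
  by rewrite lee_fin inner_restrict// nu mulr1 /y; lra.
have y1 : 0 < 1 - y m by rewrite subr_gt0.
have := heat_pairing_pow m tm Lu nu (ltW y1) ty.
rewrite mulrA mulfV ?mul1r; last by rewrite expf_neq0.
apply: le_trans.
have -> : - (l * t) / (1 - y m) = (2 ^ m)%:R * (- (y m / (1 - y m))).
  have e2 : l * t = 2 ^+ m * y m.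
    by rewrite /y mulrCA (mulrA (2 ^+ m)) mulfV ?mul1r// expf_neq0.
  rewrite e2 natrX; move: (y m) y1 => z z1.
  by field; rewrite gt_eqF.
rewrite expRM_natl ler_pXn2r ?nnegrE ?expR_ge0 ?expn_gt0 ?(ltW y1)//.
rewrite expRN -[leRHS]invrK lef_pV2 ?posrE ?expR_gt0 ?invr_gt0//.
apply: le_trans (expR_ge1Dx _).
by rewrite le_eqVlt; apply/orP; left; apply/eqP; field; rewrite gt_eqF.
Qed.

End eigenfunction_heat.

(** * The heat trace *)

Section orthonormal_family.
Context {R : realType} {n : nat}.
Variable D : set 'rV[R]_n.
Hypothesis mD : measurable D.
Local Notation L2 := (square_integrable D).
Implicit Types (E : ('rV[R]_n -> R) -> Prop).

(** Gram-Schmidt, with the induction quantified over the subspace [E]: after normalizing the first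
    vector to [v0], it continues in the part of [E] orthogonal to [v0]. Independence is modulo null
    sets, matching the vectors of norm zero. *)
Lemma orthonormal_of_independent E k (u : 'I_k -> 'rV[R]_n -> R) :
  (forall v, E v -> L2 v) ->
  (forall c v w, E v -> E w -> E (fun x => c * v x + w x)) ->
  (forall i, E (u i)) ->
  (forall c : 'I_k -> R, ae_zero D (fun x => \sum_i c i * u i x) -> forall i, c i = 0) ->
  exists v : 'I_k -> 'rV[R]_n -> R,
    (forall i, E (v i)) /\ (forall i j, inner D (v i) (v j) = (i == j)%:R).
Proof.
elim: k => [|k ih] in E u * => EL Elin Eu free.
  by exists u; split => // -[].
pose u0 := u ord0; have L0 : L2 u0 by exact/EL/Eu.
pose N0 := inner D u0 u0.
have N0_gt0 : 0 < N0.
  rewrite lt0r inner_ge0 andbT; apply/eqP => /(inner_eq0_ae mD L0) z.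
  have := free (fun i => (i == ord0)%:R) _ ord0.
  rewrite eqxx => h; suff /eqP : 1 = 0 :> R by rewrite oner_eq0.
  apply: h; move: z; congr ae_zero; apply/funext => x.
  rewrite (bigD1 ord0)//= mul1r big1 ?addr0// => i /negbTE ->.
  by rewrite mul0r.
pose s := (Num.sqrt N0)^-1.
have s2 : s * s * N0 = 1.
  by rewrite -expr2 exprVn sqr_sqrtr ?mulVf// ?gt_eqF// ltW.
pose v0 := fun x => s * u0 x.
(* [Elin] speaks of [c * v + w], so [s * u0] is written as [(s - 1) * u0 + u0]. *)
have Ev0 : E v0.
  have := Elin (s - 1) _ _ (Eu ord0) (Eu ord0); congr E.
  by apply/funext => x; rewrite /v0 /u0; ring.
have Lv0 := EL _ Ev0.
have nv0 : inner D v0 v0 = 1.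
  by rewrite /v0 innerZl ?innerZr// mulrA.
pose a j := inner D (u (lift ord0 j)) v0.
pose w (j : 'I_k) := fun x => - a j * v0 x + u (lift ord0 j) x.
pose E' := fun f => E f /\ inner D f v0 = 0.
have [||||v [Ev ov]] := ih E' w.
- by move=> f [/EL].
- move=> c f g [Ef f0] [Eg g0]; split; first exact: Elin.
  by rewrite inner_linl ?f0 ?g0 ?mulr0 ?addr0//; exact: EL.
- move=> j; split; first exact: Elin.
  by rewrite inner_linl ?nv0 ?mulr1 ?addNr//; exact/EL/Eu.
- move=> c hc j.
  (* The coefficient of [u0] in the combination of the [w j]. *)
  pose d := - (\sum_j c j * a j) * s.
  pose c' i := if unlift ord0 i is Some j then c j else d.
  have -> : c j = c' (lift ord0 j) by rewrite /c' liftK.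
  apply: free; move: hc; congr ae_zero; apply/funext => x.
  rewrite big_ord_recl /c' unlift_none.
  under [in RHS]eq_bigr do rewrite liftK.
  transitivity (\sum_j (c j * (- a j * v0 x) + c j * u (lift ord0 j) x)).
    by apply: eq_bigr => i _; rewrite /w mulrDr.
  rewrite big_split /= addrC [RHS]addrC; congr (_ + _).
  rewrite /d mulNr mulNr mulr_suml mulr_suml -sumrN; apply: eq_bigr => i _.
  by rewrite /v0 /u0; ring.
exists (fun i => if unlift ord0 i is Some j then v j else v0); split.
  by move=> i; case: unliftP => [j _|_] //; case: (Ev j).
move=> i j; case: (unliftP ord0 i) => [i' ->|->]; case: (unliftP ord0 j) => [j' ->|->].
- by rewrite ov (inj_eq lift_inj).
- by rewrite eq_sym (negbTE (neq_lift _ _)); case: (Ev i').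
- by rewrite (negbTE (neq_lift _ _)) innerC; case: (Ev j').
- by rewrite nv0 eqxx.
Qed.

End orthonormal_family.

Section heat_trace_bound.
Context {R : realType} {n : nat}.
Local Notation vol := (@lebesgue_rV R n).
Variable Omega : set 'rV[R]_n.
Hypothesis cOmega : compact Omega.
Variable t : R.
Hypothesis t0 : 0 < t.

Let B : R := fine (vol Omega) * heat_kernel t (0 : 'rV[R]_n).

Let BE : (B%:E = vol Omega * (heat_kernel t (0 : 'rV[R]_n))%:E)%E.
Proof.
by rewrite /B EFinM fineK// ge0_fin_numE// lebesgue_compact_lty.
Qed.

Lemma orthonormal_heat_sum_le (I : finType) (w : I -> 'rV[R]_n -> R) (l : I -> R) :
  (forall i, eigenfunction Omega (l i) (w i)) ->
  (forall i j, inner Omega (w i) (w j) = (i == j)%:R) ->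
  ((\sum_i expR (- l i * t))%:E <= vol Omega * (heat_kernel t (0 : 'rV[R]_n))%:E)%E.
Proof.
move=> ew ow.
apply: le_trans (heat_pairing_sum_le cOmega t0 _ ow); last first.
  by move=> i; exact: eigenfunction_square_integrable (ew i).
rewrite lee_fin; apply: ler_sum => i _.
by apply: (eigenfunction_heat_pairing cOmega t0 (ew i)); rewrite ow eqxx.
Qed.

(** The induction carries an orthonormal family [w] with eigenvalues outside [s]. For the head [m],
    [w] is enlarged by any finite orthonormal family of its eigenspace, and only then is the
    supremum defining the multiplicity taken. *)
Lemma heat_trace_seq_le (s : seq R) (I : finType) (w : I -> 'rV[R]_n -> R) (l : I -> R) :
  uniq s -> (forall i, l i \notin s) ->
  (forall i, eigenfunction Omega (l i) (w i)) ->
  (forall i j, inner Omega (w i) (w j) = (i == j)%:R) ->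
  ((\sum_i expR (- l i * t))%:E +
     \sum_(m <- s) multiplicity Omega m * (expR (- m * t))%:E <= B%:E)%E.
Proof.
elim: s => [|m s ih] in I w l * => [_ _ ew ow|/= /andP[ms us] ls ew ow].
  by rewrite big_nil adde0 BE; exact: orthonormal_heat_sum_le.
set e := expR (- m * t); have e0 : 0 < e by exact: expR_gt0.
rewrite big_cons.
set r := (\sum_(_ <- _) _)%E; set q := \sum_i _.
have step (k : nat) (u : 'I_k -> 'rV[R]_n -> R) :
    (forall i, eigenfunction Omega m (u i)) ->
    (forall c : 'I_k -> R, ae_zero Omega (fun x => \sum_i c i * u i x) -> forall i, c i = 0) ->
    ((q + k%:R * e)%:E + r <= B%:E)%E.
  move=> eu /(orthonormal_of_independent (compact_rV_measurable cOmega)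
    (@eigenfunction_square_integrable _ _ _ _) (@eigenfunction_lin _ _ _ cOmega m) eu).
  move=> [v [ev ov]].
  pose w' (x : (I + 'I_k)%type) := match x with inl i => w i | inr j => v j end.
  pose l' (x : (I + 'I_k)%type) := match x with inl i => l i | inr j => m end.
  have := ih _ w' l' us.
  rewrite big_sumType /= sumr_const card_ord -/q -/e mulr_natl; apply.
  - case=> [i|j] //=; by have := ls i; rewrite inE negb_or => /andP[].
  - by case=> [i|j] /=.
  - have lm i : l i != m by have := ls i; rewrite inE negb_or => /andP[].
    case=> [i|i] [j|j] //=.
    + exact: eigenfunction_orthogonal (ew i) (ev j) (lm i).
    + by rewrite innerC; exact: eigenfunction_orthogonal (ew j) (ev i) (lm j).
have r0 : (0 <= r)%E.
  apply: sume_ge0 => x _; rewrite mule_ge0 ?lee_fin ?expR_ge0//.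
  apply: ereal_sup_ubound; exists 0%N => //=.
  by exists (fun _ _ => 0); split => [[]|? ? []].
(* The empty family, [k = 0], shows that the remaining sum is finite, so it can be subtracted. *)
have r_fin : r \is a fin_num.
  have := @step 0%N (fun _ _ => 0) _ _; rewrite mul0r addr0 => h.
  have {}h : (q%:E + r <= B%:E)%E by apply: h => [[]|? ? []].
  rewrite ge0_fin_numE//; apply: le_lt_trans (ltry B).
  apply: le_trans h; rewrite leeDr// lee_fin sumr_ge0// => i _; exact: expR_ge0.
have rE : r = (fine r)%:E by rewrite fineK.
have : (multiplicity Omega m <= ((B - q - fine r) / e)%:E)%E.
  apply: ge_ereal_sup => _ [k [u [eu fu]] <-].
  have := step k u eu fu; rewrite rE -EFinD !lee_fin => h.
  by rewrite ler_pdivlMr//; lra.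
have e0' : (0 <= e%:E)%E by rewrite lee_fin ltW.
move=> /(lee_wpmul2r e0'); rewrite -EFinM divfK ?gt_eqF// => h.
rewrite rE addeC -addeA.
apply: (@le_trans _ _ ((B - q - fine r)%:E + ((fine r)%:E + q%:E))%E).
  exact: leeD.
by rewrite -!EFinD lee_fin; lra.
Qed.

(** [esum] is a supremum over finite sets of eigenvalues, each enumerated without repetition; the
    induction starts from the empty orthonormal family. *)
Lemma heat_trace_le :
  (heat_trace Omega t <= vol Omega * (heat_kernel t (0 : 'rV[R]_n))%:E)%E.
Proof.
rewrite -BE; apply: ge_ereal_sup => _ [A [finA _] <-].
rewrite fsbig_finite//.
have := @heat_trace_seq_le (finmap.enum_fset (fset_set A)) 'I_0 (fun _ _ => 0) (fun=> 0)
  (finmap.fset_uniq _).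
rewrite big_ord0 add0e; apply; by case.
Qed.

End heat_trace_bound.

(** * The packing constant *)

Section interior_volume.
Context {R : realType} {n : nat}.
Local Notation vol := (@lebesgue_rV R n).
Implicit Types (A : set 'rV[R]_n).

Lemma dot_continuous (v : 'rV[R]_n) : continuous (fun x => dot x v).
Proof.
move=> x; rewrite /dot; elim: (index_enum _) => [|i r ih].
  by under eq_fun do rewrite big_nil; exact: cst_continuous.
under eq_fun do rewrite big_cons.
apply: (@continuousD _ _ _ (fun z : 'rV[R]_n => z ord0 i * v ord0 i) _ x _ ih).
apply: (@continuousM _ _ (fun z : 'rV[R]_n => z ord0 i) (fun=> v ord0 i)).
  exact: coord_continuous.
exact: cst_continuous.
Qed.

Lemma lipschitz_continuous_rV (g : 'rV[R]_n -> R) :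
  [lipschitz g x | x in setT] -> continuous g.
Proof.
move=> [M [_ hM]] x; pose K := `|M| + 1.
have K0 : 0 < K by rewrite ltr_wpDl.
have hK y z : `|g y - g z| <= K * `|y - z|.
  by apply: (hM K _ (y, z)) => //; rewrite (le_lt_trans (ler_norm _))// ltrDl.
move=> U /nbhs_ballP[e /= e0 eU].
apply/nbhs_ballP; exists (e / K) => /=; first by rewrite divr_gt0.
move=> y; rewrite mx_norm_ball /ball_ /= => xy; apply: eU.
by apply: le_lt_trans (hK x y) _; rewrite mulrC -ltr_pdivlMr.
Qed.

(* At a boundary point of [A], moving along the vertical direction of the local graph
   leads to the interior. *)
Lemma lipschitz_boundary_interior A : A !=set0 -> lipschitz_boundary A ->
  interior A !=set0.
Proof.
move=> [p Ap] lA.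
have [pA|npA] := pselect (interior A p); first by exists p.
have [v [g [vv lg nA]]] := lA p (conj (@subset_closure _ A p Ap) npA).
have cg := lipschitz_continuous_rV lg.
pose F x := dot x v - g (x - dot x v *: v).
have cF : continuous F.
  have cd : continuous (fun x => dot x v) by exact: dot_continuous.
  move=> x; apply: (@continuousB _ _ _ (fun x => dot x v) _ x (cd x)).
  apply: (@continuous_comp _ _ _ (fun x => x - dot x v *: v) g); last exact: cg.
  apply: (@continuousB _ _ _ id); first by move=> U.
  exact: (@continuousZr_tmp _ _ _ (fun x => dot x v) v x (cd x)).
have nA' : \forall x \near p, 0 <= F x -> A x.
  by apply: filterS nA => x [_ h]; rewrite subr_ge0.
have Fp : 0 <= F p by rewrite subr_ge0; apply: (nbhs_singleton nA).1.
have line : {for (0 : R), continuous (fun s : R => p + s *: v)}.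
  by apply: (@continuousD _ _ _ (fun=> p)); [exact: cst_continuous|exact: scalel_continuous].
have : nbhs p (interior [set x | 0 <= F x -> A x]) by exact: nbhs_interior.
move=> hp.
have : \forall s \near (0 : R), interior [set x | 0 <= F x -> A x] (p + s *: v).
  by apply: line; rewrite /= scale0r addr0.
move=> /nbhs_ballP[e /= e0 he].
pose s := e / 2; have s0 : 0 < s by rewrite divr_gt0.
exists (p + s *: v); rewrite /interior.
(* Moving along the unit vector [v] leaves the horizontal component, hence the height of the graph,
   unchanged. *)
have Fs : 0 < F (p + s *: v).
  have -> : F (p + s *: v) = F p + s.
    rewrite /F !dotE vv mulr1 scalerDl opprD addrACA subrr addr0.
    by rewrite addrAC.
  by rewrite ltr_wpDl.
have h1 : nbhs (p + s *: v) [set x | 0 <= F x -> A x].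
  by apply: he; rewrite /ball/= sub0r normrN gtr0_norm// /s; lra.
have h2 : nbhs (p + s *: v) (F @^-1` [set z | 0 < z]).
  by apply: cF; apply: open_nbhs_nbhs; split => //; exact: open_gt.
apply: filterS (filterI h1 h2) => x [hx /= Fx]; apply: hx; exact: ltW.
Qed.

Lemma interior_lebesgue_gt0 A : measurable A -> interior A !=set0 -> (0 < vol A)%E.
Proof.
move=> mA [p /nbhs_ballP[e /= e0 he]].
pose a : 'rV[R]_n := \row_i (p ord0 i - e / 2).
pose b : 'rV[R]_n := \row_i (p ord0 i + e / 2).
pose B : set 'rV[R]_n := [set x | forall i, x ord0 i \in `]a ord0 i, b ord0 i]].
have ab i : a ord0 i <= b ord0 i by rewrite !mxE; lra.
have vB : vol B = (\prod_(i < n) (b ord0 i - a ord0 i))%:E := lebesgue_rV_box ab.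
apply: (@lt_le_trans _ _ (vol B)).
  by rewrite vB lte_fin; apply: prodr_gt0 => i _; rewrite !mxE; lra.
apply: le_measure; rewrite ?inE//.
  exact: measurable_rV_box.
move=> x Bx; apply: he; split => // i j; rewrite (ord1 i) /ball/=.
by have := Bx j; rewrite in_itv /= !mxE ltr_norml; lra.
Qed.

Lemma normal_domain_lebesgue_gt0 A : normal_domain A -> (0 < vol A)%E.
Proof.
move=> [A0 cA lA _]; apply: interior_lebesgue_gt0; first exact: compact_rV_measurable.
exact: lipschitz_boundary_interior.
Qed.

End interior_volume.

(** * Thickenings and their volume *)

Section thickening.
Context {R : realType} {n : nat}.
Local Notation vol := (@lebesgue_rV R n).
Implicit Types (A G S : set 'rV[R]_n).

(** The strict inequality makes this a union of open balls, measurable whatever [S] is. *)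
Definition thickening (e : R) S : set 'rV[R]_n := [set z | exists2 y, S y & `|z - y| < e].

Lemma thickening_measurable e S : measurable (thickening e S).
Proof.
apply: rV_open_measurable.
rewrite (_ : thickening e S = \bigcup_(y in S) ball y e).
  by apply: bigcup_open => y _; exact: ball_open.
apply/seteqP; split=> z /=.
  by move=> [y Sy zy]; exists y => //; rewrite mx_norm_ball /ball_ /= distrC.
by move=> [y Sy]; rewrite mx_norm_ball /ball_ /= distrC => zy; exists y.
Qed.

(** A compact set is the intersection of its thickenings, the first of which has finite volume;
    measure is continuous from above. *)
Lemma thickening_cvg G : compact G ->
  vol (thickening k.+1%:R^-1 G) @[k --> \oo] --> vol G.
Proof.
move=> cG.
have GE : G = \bigcap_k thickening k.+1%:R^-1 G.
  apply/seteqP; split => [z Gz k _|z hz].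
    by exists z => //; rewrite subrr normr0 invr_gt0.
  rewrite ((closure_id G).1 (compact_rV_closed cG)) => U /nbhs_ballP[e /= e0 eU].
  have [N _ H] := near_infty_natSinv_lt (PosNum e0).
  have [y Gy zy] := hz N I; exists y; split => //; apply: eU.
  rewrite mx_norm_ball /ball_ /=; apply: lt_trans zy _.
  exact: (H N (leqnn N)).
rewrite [X in _ --> vol X]GE.
apply: nonincreasing_cvg_mu.
- have [r r0 hr] := compact_rV_bounded cG.
  apply: (@le_lt_trans _ _ (vol (cball0 (r + 1)))); last exact: lebesgue_cball0.
  apply: le_measure; rewrite ?inE.
  + exact: thickening_measurable.
  + by apply: closed_rV_measurable; exact: closed_cball0.
  move=> z [y /hr yr]; rewrite invr1 => zy; rewrite /cball0 /=.
  rewrite -(subrK y z) (le_trans (ler_normD _ _))// addrC lerD//; exact: ltW.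
- by move=> k; exact: thickening_measurable.
- by rewrite -GE; exact: compact_rV_measurable.
- apply/nonincreasing_seqP => k; apply/subsetPset => z [y Gy zy].
  exists y => //; apply: lt_le_trans zy _.
  by rewrite lef_pV2 ?posrE// ler_nat.
Qed.

Lemma lebesgue_affine_preimage (l : R) (h : 'rV[R]_n) S : 0 < l -> measurable S ->
  ((l ^+ n)%:E * vol [set x | S (l *: x + h)%R] = vol S)%E.
Proof.
move=> l0 mS.
have E : (\int[vol]_x (\1_S x)%:E = vol S)%E by rewrite integral_indic// setIT.
rewrite -[in RHS]E -(@ge0_integral_affine R n l h (fun x => (\1_S x)%:E) l0)//; last first.
  by apply/measurable_EFinP; exact: measurable_indic.
congr (_ * _)%E.
have mS' : measurable [set x | S (l *: x + h)%R].
  rewrite -[X in measurable X]setTI.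
  exact: (measurable_rV_affine l h measurableT mS).
rewrite -[LHS](_ : (\int[vol]_x (\1_[set x | S (l *: x + h)%R] x)%:E = _)%E).
  by apply: eq_integral => x _; rewrite !indicE.
by rewrite integral_indic// setIT.
Qed.

(** A rotation need not preserve the maximum norm. Its rows are unit vectors, so its entries are at
    most 1 in absolute value, at the cost of the factor [n]. *)
Lemma orthogonal_norm_le (Q : 'M[R]_n) (x : 'rV[R]_n) :
  Q *m Q^T = 1%:M -> `|x *m Q| <= n%:R * `|x|.
Proof.
move=> QQ.
have Q1 i j : `|Q i j| <= 1.
  have := congr1 (fun M : 'M[R]_n => M i i) QQ; rewrite !mxE eqxx => h.
  rewrite -[leRHS]h -(@ler_pXn2r _ 2) ?nnegrE//; last first.
    by rewrite h.
  rewrite h expr1n real_normK ?num_real// -[leRHS]h (bigD1 j)//= !mxE -expr2 lerDl.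
  by apply: sumr_ge0 => k _; rewrite !mxE -expr2 sqr_ge0.
apply: rV_norm_le => [|j]; first by rewrite mulr_ge0.
rewrite mxE (le_trans (ler_norm_sum _ _ _))//.
have -> : n%:R * `|x| = \sum_(i < n) `|x| by rewrite sumr_const card_ord mulr_natl.
apply: ler_sum => i _; rewrite normrM -[leRHS]mulr1 ler_pM//.
exact: ler_coord_norm.
Qed.

End thickening.

(** * Packings have density at most 1 *)

Section packing_bound.
Context {R : realType} {n : nat}.
Local Notation vol := (@lebesgue_rV R n).
Implicit Types (A G S Omega : set 'rV[R]_n) (P : set (set 'rV[R]_n)).

Lemma mulmx_addr_continuous (Q : 'M[R]_n) (b : 'rV[R]_n) :
  continuous (fun x : 'rV[R]_n => x *m Q + b).
Proof.
move=> x U /nbhs_ballP[e /= e0 eU].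
pose K := \sum_i \sum_j `|Q i j| + 1.
have K0 : 0 < K.
  by rewrite ltr_wpDl// sumr_ge0// => i _; apply: sumr_ge0.
apply/nbhs_ballP; exists (e / K) => /=; first by rewrite divr_gt0.
move=> y; rewrite mx_norm_ball /ball_ /= ltr_pdivlMr// => xy; apply: eU.
rewrite mx_norm_ball /ball_ /= opprD addrACA subrr addr0 -mulmxBl.
apply: le_lt_trans xy; apply: rV_norm_le => [|j]; first by rewrite mulr_ge0// ltW.
rewrite mxE (le_trans (ler_norm_sum _ _ _))//.
apply: (@le_trans _ _ (\sum_i `|x - y| * `|Q i j|)).
  by apply: ler_sum => i _; rewrite normrM ler_wpM2r ?ler_coord_norm.
rewrite -mulr_sumr ler_wpM2l// (@le_trans _ _ (\sum_i \sum_j `|Q i j|))//.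
  by apply: ler_sum => i _; rewrite (bigD1 j)//= lerDl sumr_ge0.
by rewrite lerDl.
Qed.

Lemma congruent_compact A Omega : compact Omega -> congruent A Omega -> compact A.
Proof.
move=> cO [Q [b [_ ->]]]; apply: continuous_compact cO.
by apply: continuous_subspaceT; exact: mulmx_addr_continuous.
Qed.

Lemma congruent_diam (r : R) A Omega : Omega `<=` cball0 r -> congruent A Omega ->
  forall x y, A x -> A y -> `|x - y| <= n%:R * (2 * r).
Proof.
move=> Or [Q [b [QQ ->]]] _ _ [x Ox <-] [y Oy <-].
rewrite opprD addrACA subrr addr0 -mulmxBl (le_trans (orthogonal_norm_le _ QQ))//.
rewrite ler_wpM2l// (le_trans (ler_normB _ _))// mulr_natl mulr2n.
by apply: lerD; exact: Or.
Qed.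

(** The copies meeting [S] are disjoint and have diameter at most [n * (2 * D)], so they fit
    together in a thickening of [S]. The extra 1 accommodates its strict inequality. *)
Lemma outer_sum_le Omega P S (D : R) : compact Omega -> packing Omega P ->
  Omega `<=` cball0 D ->
  (\esum_(A in [set A | P A /\ A `&` S !=set0]) vol A <=
   vol (thickening (n%:R * (2 * D) + 1)%R S))%E.
Proof.
move=> cO [PO triv] OD; apply: ge_ereal_sup => _ [X [finX XP] <-].
have mX A : X A -> measurable A.
  by move=> /XP[/PO cA _]; apply: compact_rV_measurable; exact: congruent_compact cO cA.
rewrite -(@measure_fin_bigcup _ _ _ vol _ X id)//; last first.
  by apply: sub_trivIset triv => A /XP[].
apply: le_measure; rewrite ?inE.
- by apply: fin_bigcup_measurable.
- exact: thickening_measurable.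
move=> z [A XA Az]; have [PA [y [Ay Sy]]] := XP _ XA.
exists y => //; apply: (@le_lt_trans _ _ (n%:R * (2 * D))); last by rewrite ltrDl.
exact: congruent_diam OD (PO _ PA) _ _ Az Ay.
Qed.

Lemma homothetyE (o x : 'rV[R]_n) (l : R) :
  o + l *: (x - o) = l *: x + (o - l *: o).
Proof. by rewrite scalerBr addrCA. Qed.

Lemma lebesgue_homothety (o : 'rV[R]_n) (l : R) G : 0 < l -> compact G ->
  vol (homothety o l G) = ((l ^+ n)%:E * vol G)%E.
Proof.
move=> l0 cG.
have cH : compact (homothety o l G).
  rewrite (_ : homothety o l G = (fun x : 'rV[R]_n => x *m l%:M + (o - l *: o)) @` G).
    apply: continuous_compact cG; apply: continuous_subspaceT.
    exact: mulmx_addr_continuous.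
  by apply: eq_imagel => x _; rewrite mul_mx_scalar homothetyE.
rewrite -(lebesgue_affine_preimage (o - l *: o) l0); last exact: compact_rV_measurable.
congr (_ * vol _)%E; apply/seteqP; split => x /=.
  move=> [y Gy]; rewrite homothetyE => /addIr /(scalerI (lt0r_neq0 l0)) <-.
  exact: Gy.
by move=> Gx; exists x => //; rewrite homothetyE.
Qed.

Lemma lebesgue_thickening_homothety (o : 'rV[R]_n) (l e : R) G : 0 < l ->
  vol (thickening e (homothety o l G)) = ((l ^+ n)%:E * vol (thickening (e / l) G))%E.
Proof.
move=> l0.
have E x y : `|(l *: x + (o - l *: o)) - (l *: y + (o - l *: o))| = l * `|x - y|.
  by rewrite opprD addrACA subrr addr0 -scalerBr normrZ gtr0_norm.
rewrite -(lebesgue_affine_preimage (o - l *: o) l0); last exact: thickening_measurable.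
congr (_ * vol _)%E; apply/seteqP; split => x /=.
  move=> [_ [y Gy <-]]; rewrite homothetyE E => xy; exists y => //.
  by rewrite ltr_pdivlMr// mulrC.
move=> [y Gy xy]; exists (o + l *: (y - o)); first by exists y.
by rewrite homothetyE E mulrC -ltr_pdivlMr.
Qed.

(** A thickening of fixed width around the gauge at scale [l] is the scaled copy of one around [G]
    whose width is divided by [l]; the factors [l^n] cancel. *)
Lemma outer_density_le Omega P G (o : 'rV[R]_n) (l D : R) :
  compact Omega -> packing Omega P -> Omega `<=` cball0 D ->
  normal_domain G -> 0 < l ->
  (outer_density P (homothety o l G) <=
   (vol G)^-1 * vol (thickening ((n%:R * (2 * D) + 1) / l)%R G))%E.
Proof.
move=> cO packP OD nG l0; have [_ cG _ _] := nG.
have vG0 := normal_domain_lebesgue_gt0 nG.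
have vGfin : vol G \is a fin_num by rewrite ge0_fin_numE// lebesgue_compact_lty.
pose g := fine (vol G); have gE : vol G = g%:E by rewrite fineK.
have g0 : 0 < g by rewrite -lte_fin -gE.
have ln : 0 < l ^+ n by rewrite exprn_gt0.
rewrite /outer_density.
apply: (@le_trans _ _ ((vol (homothety o l G))^-1 *
   vol (thickening (n%:R * (2 * D) + 1)%R (homothety o l G)))%E).
  by rewrite lee_wpmul2l ?inve_ge0//; exact: outer_sum_le cO packP OD.
rewrite lebesgue_homothety// lebesgue_thickening_homothety// gE -EFinM !inver.
rewrite !gt_eqF ?mulr_gt0// muleA -EFinM invfM mulrAC mulVf ?gt_eqF// mul1r.
by [].
Qed.

Lemma upper_density_le1 Omega P G (o : 'rV[R]_n) : compact Omega -> packing Omega P ->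
  normal_domain G -> (upper_density P G o <= 1)%E.
Proof.
move=> cO packP nG; have [_ cG _ _] := nG.
have [D D0 OD] := compact_rV_bounded cO.
have vG0 := normal_domain_lebesgue_gt0 nG.
have vGfin : vol G \is a fin_num by rewrite ge0_fin_numE// lebesgue_compact_lty.
pose g := fine (vol G); have gE : vol G = g%:E by rewrite fineK.
have g0 : 0 < g by rewrite -lte_fin -gE.
pose c := n%:R * (2 * D) + 1.
have c0 : 0 < c by rewrite ltr_wpDl// !mulr_ge0// ltW.
apply/lee_addgt0Pr => e e0; rewrite -EFinD.
have lt_g : (vol G < (g * (1 + e))%:E)%E.
  by rewrite gE lte_fin mulrDr mulr1 ltrDl mulr_gt0.
have [k hk] : exists k, (vol (thickening k.+1%:R^-1 G) < (g * (1 + e))%:E)%E.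
  have : nbhs (vol G) [set z | (z < (g * (1 + e))%:E)%E].
    apply: open_nbhs_nbhs; split => //; exact: open_ereal_lt_ereal.
  by move=> /(thickening_cvg cG)[N _ /(_ N (leqnn N))]; exists N.
(* The upper limit is at most the supremum over the tail [l > c (k + 1)], where the width [c / l] is
   below [1 / (k + 1)]. *)
rewrite /upper_density limf_esupE.
apply: ereal_inf_le; exists (ereal_sup
  ((fun l : R => outer_density P (homothety o l G)) @` [set l | c * k.+1%:R < l])).
  by exists [set l | c * k.+1%:R < l] => //; exists (c * k.+1%:R); split => //; exact: num_real.
apply: ge_ereal_sup => _ [l /= cl <-].
have l0 : 0 < l by apply: lt_trans cl; rewrite mulr_gt0.
apply: (le_trans (outer_density_le o cO packP OD nG l0)).
have hle : (vol (thickening (c / l) G) <= (g * (1 + e))%:E)%E.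
  apply: le_trans (ltW hk); apply: le_measure; rewrite ?inE; try exact: thickening_measurable.
  move=> z [y Gy zy]; exists y => //; apply: lt_le_trans zy _.
  by rewrite ler_pdivrMr// mulrC ler_pdivlMr// ltW.
rewrite gE inver gt_eqF//.
apply: (@le_trans _ _ (g^-1%:E * (g * (1 + e))%:E)%E).
  by apply: lee_wpmul2l => //; rewrite lee_fin invr_ge0 ltW.
by rewrite -EFinM mulrA mulVf ?gt_eqF// mul1r.
Qed.

Lemma packing_constant_le1 Omega : compact Omega -> (packing_constant Omega <= 1)%E.
Proof.
move=> cO; apply: ge_ereal_sup => d; case=> P; case=> G; case=> o; case=> packP nG ->.
exact: upper_density_le1 cO packP nG.
Qed.

(** The empty packing, with [Omega] itself as gauge domain, is an admissible competitor. *)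
Lemma packing_constant_ge0 Omega : normal_domain Omega -> (0 <= packing_constant Omega)%E.
Proof.
move=> nO; apply: (@le_trans _ _ (upper_density set0 Omega 0)).
  apply: limf_esup_ge0 => [/filter_not_empty//|l].
  rewrite mule_ge0// ?inve_ge0//; exact: esum_ge0.
apply: ereal_sup_ubound; exists set0, Omega, 0; split => //.
by split => // A B [].
Qed.

End packing_bound.

Theorem mainTheorem7 (R : realType) (n : nat) (n_gt0 : (0 < n)%N)
    (Omega : set 'rV[R]_n) (normal_Omega : normal_domain Omega)
    (t : R) (t_gt0 : 0 < t) :
  (heat_trace Omega t <=
     (packing_constant Omega)^-1 *
     (lebesgue_rV Omega / ((4 * pi * t) `^ (n%:R / 2))%:E))%E.
Proof.
have [_ cO _ _] := normal_Omega.
have pt : 0 < 4 * pi * t by rewrite !mulr_gt0// pi_gt0.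
apply: (le_trans (heat_trace_le cO t_gt0)).
have -> : ((heat_kernel t (0 : 'rV[R]_n))%:E = ((4 * pi * t) `^ (n%:R / 2))%:E^-1)%E.
  rewrite heat_kernel0 inver gt_eqF ?powR_gt0//; congr (_^-1)%:E.
  by rewrite [n%:R / 2]mulrC powRrM powR12_sqrt ?(ltW pt)// powR_mulrn ?sqrtr_ge0.
(* As [delta] lies between 0 and 1, its inverse is at least 1, with [+oo] as the inverse of 0. *)
apply: lee_pemull.
  by rewrite mule_ge0// inve_ge0 lee_fin powR_ge0.
by rewrite inve_ge1 ?packing_constant_le1// packing_constant_ge0.
Qed.
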